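(* Let $n>1$ be an integer such that either $n$ is odd, or $n=2^bc$ with $b>1$ and $c>1$ odd. Then the epimorphism problem from finitely presented groups to the fixed dihedral group $D_{2n}$ of order $2n$ is $\mathsf{NP}$-hard.
   Context: The problem: given a finite presentation of a group $G$, decide whether there is a surjective homomorphism $G\to D_{2n}$ ($n$ fixed, not part of the input). *)

(* Defs.v *)
From mathcomp Require Import all_boot all_fingroup all_solvable.
Set Implicit Arguments. Unset Strict Implicit. Unset Printing Implicit Defensive.

Inductive move := MoveL | MoveR | Stay.

Unset Implicit Arguments.
Record TM := {
  tm_state : finType;
  tm_sym   : finType;
  tm_blank : tm_sym;
  tm_in    : bool -> tm_sym;
  tm_out   : tm_sym -> option bool;
  tm_start : tm_state;
  tm_halt  : pred tm_state;
  tm_acc   : pred tm_state;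
  tm_delta : tm_state -> tm_sym -> tm_state * tm_sym * move
}.
Set Implicit Arguments.

(* configuration: state, tape left of the head (nearest cell first),
   scanned symbol, tape right of the head; unlisted cells are blank *)
Definition config (M : TM) :=
  (tm_state M * seq (tm_sym M) * tm_sym M * seq (tm_sym M))%type.

Definition init_config (M : TM) (x : seq bool) : config M :=
  match x with
  | [::] => (tm_start M, [::], tm_blank M, [::])
  | b :: xs => (tm_start M, [::], tm_in M b, map (tm_in M) xs)
  end.

Definition step (M : TM) (c : config M) : config M :=
  let: (q, l, a, r) := c in
  if tm_halt M q then c else
  let: (q', a', m) := tm_delta M q a in
  match m with
  | Stay => (q', l, a', r)
  | MoveL => match l with
             | [::] => (q', [::], tm_blank M, a' :: r)
             | h :: l' => (q', l', h, a' :: r)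
             end
  | MoveR => match r with
             | [::] => (q', a' :: l, tm_blank M, [::])
             | h :: r' => (q', a' :: l, h, r')
             end
  end.

Definition run (M : TM) (t : nat) (x : seq bool) : config M :=
  iter t (@step M) (init_config M x).

Definition cstate (M : TM) (c : config M) : tm_state M :=
  let: (q, _, _, _) := c in q.

Fixpoint read_bits (M : TM) (s : seq (tm_sym M)) : seq bool :=
  match s with
  | [::] => [::]
  | a :: s' => if tm_out M a is Some b then b :: @read_bits M s' else [::]
  end.

Definition coutput (M : TM) (c : config M) : seq bool :=
  let: (_, _, a, r) := c in @read_bits M (a :: r).

Definition halts_within (M : TM) (x : seq bool) (t : nat) : bool :=
  tm_halt M (cstate (run M t x)).

Definition accepts_within (M : TM) (x : seq bool) (t : nat) : bool :=
  halts_within M x t && tm_acc M (cstate (run M t x)).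

Definition computes_within (M : TM) (x : seq bool) (t : nat) (y : seq bool) :=
  halts_within M x t /\ coutput (run M t x) = y.

Definition language := seq bool -> Prop.

Definition polyb (c k n : nat) : nat := c * n ^ k + c.

Definition pair_enc (x w : seq bool) : seq bool :=
  flatten [seq [:: b; b] | b <- x] ++ [:: false; true] ++ w.

Definition inNP (L : language) : Prop :=
  exists (V : TM) (c k : nat), forall x : seq bool,
    L x <-> exists w : seq bool,
      size w <= polyb c k (size x) /\
      accepts_within V (pair_enc x w) (polyb c k (size x)).

Definition poly_reduces (L1 L2 : language) : Prop :=
  exists (M : TM) (c k : nat), forall x : seq bool,
    exists y : seq bool,
      computes_within M x (polyb c k (size x)) y /\ (L1 x <-> L2 y).

Definition NP_hard (L : language) : Prop :=
  forall L' : language, inNP L' -> poly_reduces L' L.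

(* A finite presentation < x_0, ..., x_{m-1} | r_1, ..., r_k >.  A letter
   (i, e) stands for x_i if e = false and for x_i^-1 if e = true. *)
Record presentation := Presentation {
  pr_ngens : nat;
  pr_rels  : seq (seq ('I_pr_ngens * bool))
}.

Definition eval_word (gT : finGroupType) (m : nat) (f : 'I_m -> gT)
    (w : seq ('I_m * bool)) : gT :=
  \prod_(l <- w) (if l.2 then (f l.1)^-1 else f l.1)%g.

(* Homomorphisms from the presented group G = F(x_0..x_{m-1}) / <<r_j>>
   to a group H correspond (universal property of the presented group)
   exactly to assignments of the generators killing every relator; the
   homomorphism is onto H iff the images of the generators generate H. *)
Definition has_epi (gT : finGroupType) (H : {group gT}) (P : presentation)
    : Prop :=
  exists f : 'I_(pr_ngens P) -> gT,
    [/\ forall i, f i \in H,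
        forall r, r \in pr_rels P -> eval_word f r = 1%g
      & <<[set f i | i : 'I_(pr_ngens P)]>>%g = H].

(* Binary encoding of presentations.  Tokens of two bits:
     U = 00 (unary digit), Lp = 01 (end of letter x_i), Ln = 10 (end of
     letter x_i^-1), W = 11 (end of header / end of relator).
   enc P = U^m W  then, for each relator, its letters U^i Lp / U^i Ln,
   followed by W. *)
Definition tokU  : seq bool := [:: false; false].
Definition tokLp : seq bool := [:: false; true].
Definition tokLn : seq bool := [:: true; false].
Definition tokW  : seq bool := [:: true; true].

Definition enc_letter (m : nat) (l : 'I_m * bool) : seq bool :=
  flatten (nseq (nat_of_ord l.1) tokU) ++ (if l.2 then tokLn else tokLp).

Definition enc_word (m : nat) (w : seq ('I_m * bool)) : seq bool :=
  flatten (map (@enc_letter m) w) ++ tokW.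

Definition enc_presentation (P : presentation) : seq bool :=
  flatten (nseq (pr_ngens P) tokU) ++ tokW ++
  flatten (map (@enc_word (pr_ngens P)) (pr_rels P)).

Definition EPI (gT : finGroupType) (H : {group gT}) : language :=
  fun s => exists P : presentation, s = enc_presentation P /\ has_epi H P.

(* Main.v *)
Require Import Defs.
From mathcomp Require Import all_boot all_fingroup all_solvable.
From mathcomp Require Import zify.
Set Implicit Arguments. Unset Strict Implicit. Unset Printing Implicit Defensive.

(** Take generators s, a and y_i, with s and the y_i pairwise commuting
involutions, and read the Boolean variable i as "y_i is a reflection". If l_1,
..., l_k are reflections among the y_i and s y_i, then the left-normed commutator
[a, l_1, ..., l_k] is the power of exponent 2^k or -2^k of a rotation, and it
is trivial as soon as some l_j is central. When the generators generate the
dihedral group of order 2n and n is not a power of two, that power cannot be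
trivial: otherwise all rotations would have order dividing 2^k. Hence the relator
[a, l_1, ..., l_k] is a clause, and the relators [a, y_i, s y_i] force s to be a
reflection, so that s y_i is the negation of y_i. With clauses of bounded length
one writes down the tableau of a verifier (Cook-Levin).

The presentation is printed by a program with nested loops over unary counters.
A Turing machine executes such a program with one track of its tape for each
counter and one sweep over the tape for each elementary instruction. *)

(** * Turing machines with an absolute tape *)

(** The images of the generators are not known in advance: for even n a [y_i] may be sent to the
    central rotation of order two, and nothing says that [a] goes to a rotation. The torsion
    argument avoids classifying them. Fix the first reflection l of a clause and call the rotation
    part of g whichever of g and l g is a rotation. The elements whose rotation part is killed by
    2^k form a subgroup. It contains s, the [y_i] and the s [y_i], since these are involutions that
    are rotations or commute with l; it contains [a] because the commutator is trivial. Hence it is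
    the whole group. On the tableau side, no clauses force the variables of a cell to single out one
    content: decoding is total, and a constraint on boundedly many cells is the exclusion of
    finitely many bit patterns. These depend only on the verifier, so they are unrolled in the text
    of the printing program, and only cell numbers are computed at run time. *)

Section Update.
Variables (V : eqType) (A : Type).

Definition upd (f : V -> A) v a := fun u => if u == v then a else f u.

Lemma upd_same f v a : upd f v a v = a. Proof. by rewrite /upd eqxx. Qed.

Lemma upd_other f v a u : u != v -> upd f v a u = f u.
Proof. by rewrite /upd => /negbTE->. Qed.

End Update.

Section AbsoluteTape.
Variable M : TM.
Implicit Types (c : config M) (tp : nat -> tm_sym M).
Local Notation blank := (tm_blank M).

(** Lists are compared after padding with blanks, so trailing blanks do not matter. Everything to
    the left of position 0 is required to be blank. *)
Definition represents c q pos tp : Prop :=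
  let: (q', l, a, r) := c in
  [/\ q' = q, a = tp pos, forall i, nth blank r i = tp (pos + i.+1)
    & forall i, nth blank l i = if i < pos then tp (pos - i.+1) else blank].

Definition moved m pos :=
  match m with MoveL => pos.-1 | MoveR => pos.+1 | Stay => pos end.

Lemma eq_represents c q pos tp tp' :
  tp =1 tp' -> represents c q pos tp -> represents c q pos tp'.
Proof.
move=> e; case: c => [[[q' l] a] r] [-> -> Hr Hl]; split=> //.
- by move=> i; rewrite Hr e.
- by move=> i; rewrite Hl e.
Qed.

Lemma represents_state c q pos tp : represents c q pos tp -> cstate c = q.
Proof. by case: c => [[[q' l] a] r] []. Qed.

Lemma step_halted c : tm_halt M (cstate c) -> step c = c.
Proof. by case: c => [[[q l] a] r] /= ->. Qed.

Lemma iter_step_halted c t : tm_halt M (cstate c) -> iter t (@step M) c = c.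
Proof. by move=> h; elim: t => //= t ->; apply: step_halted. Qed.

(** The condition on [MoveL] keeps the head off the negative positions, which [tp] does not describe
    and where [pos.-1] would be truncated. *)
Lemma represents_step c q pos tp q' a' m :
  represents c q pos tp -> ~~ tm_halt M q ->
  tm_delta M q (tp pos) = (q', a', m) -> (m = MoveL -> 0 < pos) ->
  represents (step c) q' (moved m pos) (upd tp pos a').
Proof.
case: c => [[[q1 l] a] r] /= [-> -> Hr Hl] /negbTE nh d Hm; rewrite nh d.
case: m d Hm => /= d Hm.
- have {Hm} p0 := Hm erefl.
  case: l Hl => [|h l] Hl; split=> //.
  + by have := Hl 0; rewrite p0 /= /upd; case: eqP => [|_ ->]; [lia | congr tp; lia].
  + case=> [|i] /=; first by rewrite addn1 prednK // upd_same.
    by rewrite Hr /upd; case: eqP => [|_]; [lia | congr tp; lia].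
  + move=> i; have := Hl i.+1; rewrite nth_nil /= nth_nil /upd => e.
    case: ltnP => Hi //; case: eqP => [|_]; first lia.
    rewrite e; have -> : (i.+1 < pos) by lia.
    by congr tp; lia.
  + by have := Hl 0; rewrite p0 /= /upd; case: eqP => [|_ ->]; [lia | congr tp; lia].
  + case=> [|i] /=; first by rewrite addn1 prednK // upd_same.
    by rewrite Hr /upd; case: eqP => [|_]; [lia | congr tp; lia].
  + move=> i; have /= -> := Hl i.+1; rewrite /upd.
    have -> : (i.+1 < pos) = (i < pos.-1) by lia.
    case: ltnP => Hi //; case: eqP => [|_]; first lia.
    by congr tp; lia.
- have left_ok i : nth blank (a' :: l) i =
      if i < pos.+1 then upd tp pos a' (pos.+1 - i.+1) else blank.
    case: i => [|i] /=; first by rewrite subSS subn0 upd_same.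
    rewrite Hl ltnS subSS /upd; case: ltnP => Hi //.
    by case: eqP => [|_]; [lia | congr tp; lia].
  case: r Hr => [|h r] Hr; split=> //.
  + have := Hr 0; rewrite nth_nil /= addn1 => ->.
    by rewrite upd_other //; lia.
  + move=> i; have := Hr i.+1; rewrite !nth_nil => ->.
    by rewrite upd_other ?addnS //; lia.
  + by have := Hr 0; rewrite /= addn1 => ->; rewrite upd_other //; lia.
  + move=> i; have /= -> := Hr i.+1.
    by rewrite upd_other ?addnS ?addSn //; lia.
- split=> //; first by rewrite upd_same.
  + by move=> i; rewrite Hr upd_other //; lia.
  + by move=> i; rewrite Hl; case: ltnP => // Hi; rewrite upd_other //; lia.
Qed.

Lemma represents_init x :
  represents (init_config M x) (tm_start M) 0 (fun i => nth blank (map (tm_in M) x) i).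
Proof. by case: x => [|b x]; split=> // i; rewrite ?nth_nil ?add0n. Qed.

Lemma read_bits_nth s (y : seq bool) :
  (forall i, tm_out M (nth blank s i) = onth y i) -> size y <= size s ->
  read_bits s = y.
Proof.
elim: s y => [|a s IH] [|b y] // H; move: (H 0) => /= -> //= Hs.
by congr cons; apply: IH => // i; have := H i.+1.
Qed.

Lemma coutput_represents c q tp (y : seq bool) :
  represents c q 0 tp -> tm_out M blank = None ->
  (forall i, tm_out M (tp i) = onth y i) -> coutput c = y.
Proof.
case: c => [[[q' l] a] r] [_ -> Hr _] Hb Hy; apply: read_bits_nth => [[|i]|].
- exact: Hy.
- by rewrite /= Hr Hy.
(* The first cell not listed is blank and a blank has no output bit, so [y] is no longer than the
   listed part of the tape. *)
- have := Hr (size r); rewrite nth_default // add0n => Hs.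
  by rewrite -onthNE -Hy -Hs Hb.
Qed.

End AbsoluteTape.

(** * Sweep machines *)

Section SweepMachine.
Variable V : finType.

(* The flag marks the leftmost cell used; the other components are the input
   track, the output track, and one unary counter per variable. *)
Definition cell : finType := (bool * option bool * option bool * {ffun V -> bool})%type.

Definition mkcell e i o m : cell := (e, i, o, m).
Definition cend (a : cell) : bool := a.1.1.1.
Definition cinp (a : cell) : option bool := a.1.1.2.
Definition cout (a : cell) : option bool := a.1.2.
Definition cmark (a : cell) : {ffun V -> bool} := a.2.
Definition set_mark v b (a : cell) : cell :=
  (a.1, [ffun u => if u == v then b else a.2 u]).
Definition set_out o (a : cell) : cell := (a.1.1, o, a.2).
Definition set_end (a : cell) : cell := (true, a.1.1.2, a.1.2, a.2).

(* Scan right, rewriting by [pass], as long as [cond] holds; rewrite the first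
   cell violating [cond] by [fin], then return to the leftmost cell and jump to
   the first or second label according to the value of [res] on that cell. *)
Record sweep := Sweep {
  cond : cell -> bool; pass : cell -> cell; fin : cell -> cell; res : cell -> bool }.

Definition instr := (sweep * nat * nat)%type.
Definition nop : sweep := Sweep (fun=> false) id id (fun=> true).
Definition nopi : instr := (nop, 0, 0).

Definition phase : finType := option bool.
Definition init_phase : phase := None.
Definition scan : phase := Some false.
Definition rewind : phase := Some true.

(** The extra label [size pr], one past the last instruction, is where the machine halts. The last
    cell of a sweep is rewritten without moving, so a sweep that stops on cell 0 needs no special
    case. *)
Definition sm_delta (pr : seq instr) (q : 'I_(size pr).+1 * phase) (a : cell) :=
  let: (pc, ph) := q in
  match ph with
  | None => ((pc, scan), set_end a, Stay)
  | Some true => if cend a then ((pc, scan), a, Stay) else ((pc, rewind), a, MoveL)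
  | Some false =>
      let: (s, jt, jf) := nth nopi pr pc in
      if cond s a then ((pc, scan), pass s a, MoveR)
      else ((inord (if res s a then jt else jf), rewind), fin s a, Stay)
  end.

Definition sweep_machine (pr : seq instr) : TM := {|
  tm_state := ('I_(size pr).+1 * phase)%type;
  tm_sym := cell;
  tm_blank := mkcell false None None [ffun=> false];
  tm_in := fun b => mkcell false (Some b) None [ffun=> false];
  tm_out := cout;
  tm_start := (ord0, init_phase);
  tm_halt := fun q => (q.1 == size pr :> nat) && (q.2 == scan);
  tm_acc := fun=> true;
  tm_delta := @sm_delta pr |}.

Section Runs.
Variable pr : seq instr.
Local Notation M := (sweep_machine pr).
Implicit Types (c : config M) (tp : nat -> cell).

Definition at_label c (pc : nat) tp :=
  represents c ((inord pc, scan) : tm_state M) 0 tp.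

Lemma eq_at_label c pc tp tp' : tp =1 tp' -> at_label c pc tp -> at_label c pc tp'.
Proof. by move=> e; apply: (@eq_represents M). Qed.

Lemma running (pc : nat) ph : pc < size pr ->
  ~~ tm_halt M (inord pc, ph).
Proof. by move=> h; rewrite /= inordK ?ltnS ?(ltnW h) // (ltn_eqF h). Qed.

Lemma not_scan_running (q : 'I_(size pr).+1) ph :
  ph != scan -> ~~ tm_halt M (q, ph).
Proof. by move=> /negbTE h; rewrite /= h andbF. Qed.

Definition swept (s : sweep) j tp i :=
  if i < j then pass s (tp i) else if i == j then fin s (tp j) else tp i.

Lemma scan_run c pc s jt jf tp j : pc < size pr ->
  nth nopi pr pc = (s, jt, jf) -> at_label c pc tp ->
  (forall i, i < j -> cond s (tp i)) ->
  represents (iter j (@step M) c) ((inord pc, scan) : tm_state M) j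
    (fun i => if i < j then pass s (tp i) else tp i).
Proof.
move=> hpc hs hc; elim: j => [|j IH] hj //.
have {}IH := IH (fun i hi => hj i (ltnW hi)).
have := represents_step (q' := (inord pc, scan) : tm_state M) (a' := pass s (tp j)) (m := MoveR) IH.
rewrite running //= ltnn inordK ?ltnS ?(ltnW hpc) // hs hj // => /(_ isT erefl) H.
apply: eq_represents (H _) => // i; rewrite /upd.
case: eqP => [->|ne]; first by rewrite ltnSn.
by have -> : (i < j.+1) = (i < j) by lia.
Qed.

Lemma rewind_run c (q : 'I_(size pr).+1) tp j :
  represents c ((q, rewind) : tm_state M) j tp ->
  (forall i, cend (tp i) = (i == 0)) ->
  represents (iter j.+1 (@step M) c) ((q, scan) : tm_state M) 0 tp.
Proof.
move=> + he; elim: j c => [|j IH] c hc.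
  have := represents_step (q' := (q, scan) : tm_state M) (a' := tp 0) (m := Stay) hc.
  rewrite not_scan_running //= he => /(_ isT erefl) H.
  by apply: eq_represents (H _) => // i; rewrite /upd; case: eqP => // ->.
rewrite iterSr; apply: IH.
have := represents_step (q' := (q, rewind) : tm_state M) (a' := tp j.+1) (m := MoveL) hc.
rewrite not_scan_running //= he => /(_ isT erefl) H.
by apply: eq_represents (H _) => // i; rewrite /upd; case: eqP => // ->.
Qed.

Lemma sweep_run c pc s jt jf tp j : pc < size pr ->
  nth nopi pr pc = (s, jt, jf) -> at_label c pc tp ->
  (forall i, cend (swept s j tp i) = (i == 0)) ->
  (forall i, i < j -> cond s (tp i)) -> ~~ cond s (tp j) ->
  at_label (iter (j.*2 + 2) (@step M) c) (if res s (tp j) then jt else jf)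
    (swept s j tp).
Proof.
move=> hpc hs hc he hj /negbTE hn.
have H1 := scan_run hpc hs hc hj.
(* There are [j] moves right, one rewriting step, [j] moves left, and one step that recognises the
   flagged cell. *)
rewrite (_ : j.*2 + 2 = j.+1 + (1 + j)); last by lia.
rewrite iterD iterD; apply: rewind_run => //=.
have := represents_step
  (q' := (inord (if res s (tp j) then jt else jf), rewind) : tm_state M)
  (a' := fin s (tp j)) (m := Stay) H1.
rewrite running //= ltnn inordK ?ltnS ?(ltnW hpc) // hs hn => /(_ isT erefl) H.
apply: eq_represents (H _) => // i; rewrite /upd /swept.
by case: eqP => [->|]; rewrite ?ltnn.
Qed.

End Runs.
End SweepMachine.

(** * Loop programs and their compilation *)

Section LoopPrograms.
Variable V : finType.

(* [For v u E] runs [E] with [v] = 0, ..., [u] - 1; [Let v E1 E2] counts the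
   bits that [E1] would emit and runs [E2] with [v] set to that number;
   [IfIn v E1 E2] branches on bit [v] of the input. *)
Inductive prog :=
  | Emit of seq bool
  | Cat of prog & prog
  | For of V & V & prog
  | Let of V & prog & prog
  | IfIn of V & prog & prog.

Fixpoint vars E : seq V :=
  match E with
  | Emit _ => [::]
  | Cat E1 E2 => vars E1 ++ vars E2
  | For v u E => v :: u :: vars E
  | Let v E1 E2 => v :: vars E1 ++ vars E2
  | IfIn v E1 E2 => v :: vars E1 ++ vars E2
  end.

Fixpoint bound E : seq V :=
  match E with
  | Emit _ => [::]
  | Cat E1 E2 => bound E1 ++ bound E2
  | For v u E => v :: bound E
  | Let v E1 E2 => v :: bound E1 ++ bound E2
  | IfIn v E1 E2 => bound E1 ++ bound E2
  end.

(** The body of a loop may rebind neither its index nor its limit; the program counted into [v] may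
    not see the partial count; the program that uses the count may not rebind [v]. *)
Fixpoint wf E : bool :=
  match E with
  | Emit _ => true
  | Cat E1 E2 => wf E1 && wf E2
  | For v u E => [&& v != u, v \notin bound E, u \notin bound E & wf E]
  | Let v E1 E2 => [&& v \notin vars E1, v \notin bound E2, wf E1 & wf E2]
  | IfIn v E1 E2 => wf E1 && wf E2
  end.

Lemma bound_vars E : {subset bound E <= vars E}.
Proof.
elim: E => //= [E1 IH1 E2 IH2|v u E IH|v E1 IH1 E2 IH2|v E1 IH1 E2 IH2] w.
- by rewrite !mem_cat => /orP[/IH1->|/IH2->]; rewrite ?orbT.
- by rewrite !inE => /orP[->|/IH->]; rewrite ?orbT.
- by rewrite !inE !mem_cat => /or3P[->|/IH1->|/IH2->]; rewrite ?orbT.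
- by rewrite !inE !mem_cat => /orP[/IH1->|/IH2->]; rewrite ?orbT.
Qed.

Section Semantics.
Variable x : seq bool.
Implicit Types (E : prog) (sg : V -> nat).

Fixpoint sem E sg : seq bool :=
  match E with
  | Emit s => s
  | Cat E1 E2 => sem E1 sg ++ sem E2 sg
  | For v u E => flatten [seq sem E (upd sg v i) | i <- iota 0 (sg u)]
  | Let v E1 E2 => sem E2 (upd sg v (size (sem E1 sg)))
  | IfIn v E1 E2 => if nth false x (sg v) then sem E1 sg else sem E2 sg
  end.

(** A bound on the number of sweeps of the compiled program. A loop round pays for a test and an
    increment, the exit for the failing test and the clearing of the index. By [size_sem] it also
    bounds the number of emitted bits. *)
Fixpoint cost E sg : nat :=
  match E with
  | Emit s => size s
  | Cat E1 E2 => cost E1 sg + cost E2 sg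
  | For v u E => \sum_(0 <= i < sg u) (cost E (upd sg v i) + 2) + 2
  | Let v E1 E2 => cost E1 sg + cost E2 (upd sg v (size (sem E1 sg))) + 1
  | IfIn v E1 E2 => (if nth false x (sg v) then cost E1 sg else cost E2 sg) + 2
  end.

(** Needed because a program whose output is redirected runs while the target counter, which it does
    not mention, keeps changing. *)
Lemma eq_in_sem E sg sg' :
  {in vars E, sg =1 sg'} -> sem E sg = sem E sg' /\ cost E sg = cost E sg'.
Proof.
elim: E sg sg' => [s|E1 IH1 E2 IH2|v u E IH|v E1 IH1 E2 IH2|v E1 IH1 E2 IH2]
  sg sg' //= h.
- have [|-> ->] := IH1 sg sg'; first by move=> w hw; apply: h; rewrite mem_cat hw.
  have [|-> ->//] := IH2 sg sg'; first by move=> w hw; apply: h; rewrite mem_cat hw orbT.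
- rewrite -h ?inE ?eqxx ?orbT //.
  have {}IH i : sem E (upd sg v i) = sem E (upd sg' v i) /\
             cost E (upd sg v i) = cost E (upd sg' v i).
    by apply: IH => w hw; rewrite /upd; case: eqP => // _; apply: h; rewrite !inE hw !orbT.
  split; first by congr flatten; apply: eq_map => i; apply: (IH i).1.
  by congr (_ + 2); apply: eq_bigr => i _; rewrite (IH i).2.
- have [|-> ->] := IH1 sg sg'.
    by move=> w hw; apply: h; rewrite inE mem_cat hw orbT.
  have [|-> ->//] := IH2 (upd sg v (size (sem E1 sg'))) (upd sg' v (size (sem E1 sg'))).
  move=> w hw; rewrite /upd; case: eqP => // _.
  by apply: h; rewrite inE mem_cat hw !orbT.
- rewrite -h ?inE ?eqxx //.
  have [|-> ->] := IH1 sg sg'.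
    by move=> w hw; apply: h; rewrite inE mem_cat hw orbT.
  have [|-> ->//] := IH2 sg sg'.
  by move=> w hw; apply: h; rewrite inE mem_cat hw !orbT.
Qed.

Lemma size_sem E sg : size (sem E sg) <= cost E sg.
Proof.
elim: E sg => [s|E1 IH1 E2 IH2|v u E IH|v E1 IH1 E2 IH2|v E1 IH1 E2 IH2] sg //=.
- by rewrite size_cat leq_add.
- apply: leq_trans (leq_addr _ _); rewrite size_flatten /shape -map_comp sumnE big_map.
  rewrite /index_iota subn0; apply: leq_sum => i _.
  exact: leq_trans (IH _) (leq_addr _ _).
- by have := IH2 (upd sg v (size (sem E1 sg))); lia.
- by case: ifP => _; apply: leq_trans (leq_addr _ _).
Qed.

End Semantics.

Section Compile.

(** A counter of value k marks the cells 0, ..., k - 1 of its track, so a scan along its marks stops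
    at cell k. Marking that cell increments the counter; reading the track of [u] there decides
    whether k is below the value of [u]; reading the input track there gives bit k. *)
Definition inc_op v : sweep V :=
  Sweep (fun a => cmark a v) id (set_mark v true) (fun=> true).
Definition clr_op v : sweep V :=
  Sweep (fun a => cmark a v) (set_mark v false) id (fun=> true).
Definition emit_op b : sweep V :=
  Sweep (fun a => isSome (cout a)) id (set_out (Some b)) (fun=> true).
Definition lt_op v u : sweep V :=
  Sweep (fun a => cmark a v) id id (fun a => cmark a u).
Definition in_op v : sweep V :=
  Sweep (fun a => cmark a v) id id (fun a => cinp a == Some true).
Definition len_op v : sweep V :=
  Sweep (fun a => isSome (cinp a)) (set_mark v true) id (fun=> true).

(* The target of the emitted bits: the output track, or a counter to increment. *)
Definition put_op (tgt : option V) b := if tgt is Some w then inc_op w else emit_op b.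

Fixpoint code_emit tgt s a : seq (instr V) :=
  if s is b :: s' then (put_op tgt b, a.+1, a.+1) :: code_emit tgt s' a.+1 else [::].

Fixpoint len E : nat :=
  match E with
  | Emit s => size s
  | Cat E1 E2 => len E1 + len E2
  | For v u E => len E + 3
  | Let v E1 E2 => len E1 + len E2 + 1
  | IfIn v E1 E2 => len E1 + len E2 + 2
  end.

(** Jumps are absolute, for code placed at address [a]. The counters bound by [For] and [Let] are
    cleared on exit, so that enclosing loops find them at zero again. *)
Fixpoint code E tgt a : seq (instr V) :=
  match E with
  | Emit s => code_emit tgt s a
  | Cat E1 E2 => code E1 tgt a ++ code E2 tgt (a + len E1)
  | For v u E =>
      (lt_op v u, a.+1, a.+2 + len E) :: code E tgt a.+1 ++
      [:: (inc_op v, a, a); (clr_op v, a + (len E + 3), a + (len E + 3))]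
  | Let v E1 E2 =>
      code E1 (Some v) a ++ code E2 tgt (a + len E1) ++
      [:: (clr_op v, a + (len E1 + len E2 + 1), a + (len E1 + len E2 + 1))]
  | IfIn v E1 E2 =>
      (in_op v, a.+1, a.+2 + len E1) :: code E1 tgt a.+1 ++
      (nop V, a + (len E1 + len E2 + 2), a + (len E1 + len E2 + 2)) ::
      code E2 tgt (a.+2 + len E1)
  end.

Lemma size_code E tgt a : size (code E tgt a) = len E.
Proof.
elim: E tgt a => [s|E1 IH1 E2 IH2|v u E IH|v E1 IH1 E2 IH2|v E1 IH1 E2 IH2]
  tgt a /=; rewrite ?size_cat /= ?size_cat /= ?IH1 ?IH2 ?IH /=; try lia.
by elim: s a => //= b s IH a; rewrite IH.
Qed.

Variables (x : seq bool) (pr : seq (instr V)) (B : nat).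
Implicit Types (E : prog) (sg : V -> nat).
Local Notation M := (sweep_machine pr).

Definition tape sg (o : seq bool) i : cell V :=
  mkcell (i == 0) (onth x i) (onth o i) [ffun v => i < sg v].

Lemma eq_tape sg sg' o : sg =1 sg' -> tape sg o =1 tape sg' o.
Proof. by move=> e i; rewrite /tape; congr mkcell; apply/ffunP => v; rewrite !ffunE e. Qed.

Lemma mark_tape sg o i v : cmark (tape sg o i) v = (i < sg v).
Proof. by rewrite /cmark /= ffunE. Qed.

(** Time is counted in sweeps: [k] of them, none going beyond cell [B], hence [B.*2 + 2] machine
    steps for each. *)
Definition goes pc sg o k pc' sg' o' := forall c : config M,
  at_label c pc (tape sg o) -> exists2 t, t <= k * (B.*2 + 2) &
  at_label (iter t (@step M) c) pc' (tape sg' o').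

Lemma goes_refl pc sg o sg' : sg =1 sg' -> goes pc sg o 0 pc sg' o.
Proof. by move=> e c hc; exists 0 => //; apply: eq_represents hc; apply: eq_tape. Qed.

Lemma goes_trans pc1 sg1 o1 k pc2 sg2 o2 k' pc3 sg3 o3 :
  goes pc1 sg1 o1 k pc2 sg2 o2 -> goes pc2 sg2 o2 k' pc3 sg3 o3 ->
  goes pc1 sg1 o1 (k + k') pc3 sg3 o3.
Proof.
move=> h1 h2 c /h1[t1 l1 /h2[t2 l2 h]]; exists (t2 + t1); last by rewrite iterD.
by rewrite mulnDl addnC leq_add.
Qed.

Lemma goes_eqr pc sg o k pc' sg' o' sg'' :
  sg' =1 sg'' -> goes pc sg o k pc' sg' o' -> goes pc sg o k pc' sg'' o'.
Proof.
by move=> e h; rewrite -[k]addn0; apply: goes_trans h _; apply: goes_refl.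
Qed.

Lemma goes_leq pc sg o k k' pc' sg' o' :
  k <= k' -> goes pc sg o k pc' sg' o' -> goes pc sg o k' pc' sg' o'.
Proof.
by move=> l h c /h[t lt ht]; exists t => //; apply: leq_trans lt _; rewrite leq_mul2r l orbT.
Qed.

Lemma goes_sweep pc s jt jf sg o j sg' o' : pc < size pr ->
  nth (nopi V) pr pc = (s, jt, jf) -> j <= B ->
  (forall i, i < j -> cond s (tape sg o i)) -> ~~ cond s (tape sg o j) ->
  swept s j (tape sg o) =1 tape sg' o' ->
  goes pc sg o 1 (if res s (tape sg o j) then jt else jf) sg' o'.
Proof.
move=> hpc hs hB hj hn e c hc; exists (j.*2 + 2).
  by rewrite mul1n leq_add2r leq_double.
by apply: (eq_at_label e); apply: (sweep_run hpc hs hc _ hj hn) => i; rewrite e.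
Qed.

Lemma swept_id s j sg o sg' : (forall a, pass s a = a) -> (forall a, fin s a = a) ->
  sg =1 sg' -> swept s j (tape sg o) =1 tape sg' o.
Proof.
move=> hp hf e i; rewrite /swept; case: ifP => _; first by rewrite hp (eq_tape _ e).
by case: eqP => [->|_]; rewrite ?hf (eq_tape _ e).
Qed.

Section Ops.
Variables (pc jt jf : nat) (sg : V -> nat) (o : seq bool).
Hypothesis hpc : pc < size pr.

Lemma goes_inc v : nth (nopi V) pr pc = (inc_op v, jt, jf) -> sg v <= B ->
  goes pc sg o 1 jt (upd sg v (sg v).+1) o.
Proof.
move=> hs hB; apply: (goes_sweep (j := sg v) hpc hs hB) => [i hi||i] /=.
- by rewrite (mark_tape _ o).
- by rewrite (mark_tape _ o) ltnn.
- rewrite /swept /tape /mkcell /set_mark /=; case: ltngtP => hi.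
  + congr (_, _); apply/ffunP => w; rewrite !ffunE /upd; case: eqP => // e; rewrite ?e; lia.
  + congr (_, _); apply/ffunP => w; rewrite !ffunE /upd; case: eqP => // e; rewrite ?e; lia.
  + rewrite -hi; congr (_, _); apply/ffunP => w; rewrite !ffunE /upd; case: eqP => // e; rewrite ?e; lia.
Qed.

Lemma goes_clr v : nth (nopi V) pr pc = (clr_op v, jt, jf) -> sg v <= B ->
  goes pc sg o 1 jt (upd sg v 0) o.
Proof.
move=> hs hB; apply: (goes_sweep (j := sg v) hpc hs hB) => [i hi||i] /=.
- by rewrite (mark_tape _ o).
- by rewrite (mark_tape _ o) ltnn.
- rewrite /swept /tape /mkcell /set_mark /=; case: ltngtP => hi.
  + congr (_, _); apply/ffunP => w; rewrite !ffunE /upd; case: eqP => // e; rewrite ?e; lia.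
  + congr (_, _); apply/ffunP => w; rewrite !ffunE /upd; case: eqP => // e; rewrite ?e; lia.
  + rewrite -hi; congr (_, _); apply/ffunP => w; rewrite !ffunE /upd; case: eqP => // e; rewrite ?e; lia.
Qed.

Lemma goes_emit b : nth (nopi V) pr pc = (emit_op b, jt, jf) -> size o <= B ->
  goes pc sg o 1 jt sg (rcons o b).
Proof.
move=> hs hB; apply: (goes_sweep (j := size o) hpc hs hB) => [i hi||i] /=.
- by rewrite onthTE.
- by rewrite onthTE ltnn.
- rewrite /swept /tape /mkcell /set_out /= -cats1 onth_cat; case: ltngtP => // hi.
  + by rewrite (@onth_default _ i o (ltnW hi)) (@onth_default _ _ [:: b]) ?subn_gt0.
  + by rewrite -hi /set_out /= subnn.
Qed.

Lemma goes_lt v u : nth (nopi V) pr pc = (lt_op v u, jt, jf) -> sg v <= B ->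
  goes pc sg o 1 (if sg v < sg u then jt else jf) sg o.
Proof.
move=> hs hB; have := @goes_sweep _ _ _ _ sg o (sg v) sg o hpc hs hB.
rewrite /= !ffunE ltnn; apply=> //; first by move=> i hi; rewrite ffunE.
exact: swept_id.
Qed.

Lemma goes_in v : nth (nopi V) pr pc = (in_op v, jt, jf) -> sg v <= B ->
  goes pc sg o 1 (if nth false x (sg v) then jt else jf) sg o.
Proof.
move=> hs hB; have := @goes_sweep _ _ _ _ sg o (sg v) sg o hpc hs hB.
rewrite /= !ffunE ltnn (_ : cinp _ == _ = nth false x (sg v)); last first.
  by rewrite /cinp /= -odflt_onth; case: onth => // -[].
apply=> //; first by move=> i hi; rewrite ffunE.
exact: swept_id.
Qed.

Lemma goes_nop : nth (nopi V) pr pc = (nop V, jt, jf) -> goes pc sg o 1 jt sg o.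
Proof. by move=> hs; apply: (goes_sweep (j := 0) hpc hs) => //; apply: swept_id. Qed.

Lemma goes_len v : nth (nopi V) pr pc = (len_op v, jt, jf) -> sg v = 0 ->
  size x <= B -> goes pc sg o 1 jt (upd sg v (size x)) o.
Proof.
move=> hs h0 hB; apply: (goes_sweep (j := size x) hpc hs hB) => [i hi||i] /=.
- by rewrite onthTE.
- by rewrite onthTE ltnn.
- rewrite /swept /tape /mkcell /set_mark /=; case: ltngtP => hi.
  + congr (_, _); apply/ffunP => w; rewrite !ffunE /upd; case: eqP => // e; rewrite ?e; lia.
  + congr (_, _); apply/ffunP => w; rewrite !ffunE /upd; case: eqP => // e; rewrite ?e; lia.
  + rewrite -hi; congr (_, _); apply/ffunP => w; rewrite !ffunE /upd; case: eqP => // e; rewrite ?e; lia.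
Qed.

End Ops.

Definition code_at a cd := exists p1 p2, pr = p1 ++ cd ++ p2 /\ size p1 = a.

Lemma code_at_cat a c1 c2 :
  code_at a (c1 ++ c2) -> code_at a c1 /\ code_at (a + size c1) c2.
Proof.
move=> [p1 [p2 [e <-]]]; split; first by exists p1, (c2 ++ p2); rewrite e -catA.
by exists (p1 ++ c1), p2; rewrite e size_cat -!catA.
Qed.

Lemma code_at_cons a i cd : code_at a (i :: cd) ->
  [/\ a < size pr, nth (nopi V) pr a = i & code_at a.+1 cd].
Proof.
move=> h; have [_] := @code_at_cat a [:: i] cd h; rewrite addn1.
case: h => [p1 [p2 [e <-]]] ?; split=> //.
  by rewrite e !size_cat /=; lia.
by rewrite e nth_cat ltnn subnn.
Qed.

(** With [k] the cost still to be paid, this room for growth keeps all later sweeps within [B]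
    cells. *)
Definition fits sg (o : seq bool) k := (forall w, sg w + k <= B) /\ size o + k <= B.

Definition put_store (tgt : option V) sg (s : seq bool) :=
  if tgt is Some w then upd sg w (sg w + size s) else sg.
Definition put_out (tgt : option V) (o s : seq bool) := if tgt is Some _ then o else o ++ s.

Lemma put_store_le tgt sg s w : put_store tgt sg s w <= sg w + size s.
Proof. by case: tgt => [v|] /=; rewrite ?leq_addr // /upd; case: eqP => [->|_] //; rewrite leq_addr. Qed.

Lemma put_out_le tgt o s : size (put_out tgt o s) <= size o + size s.
Proof. by case: tgt => [v|] /=; rewrite ?leq_addr // size_cat. Qed.

Lemma put_store_cat tgt sg s1 s2 :
  put_store tgt (put_store tgt sg s1) s2 =1 put_store tgt sg (s1 ++ s2).
Proof.
by case: tgt => [v|] //= w; rewrite /upd size_cat addnA eqxx; case: eqP.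
Qed.

Lemma put_out_cat tgt o s1 s2 :
  put_out tgt (put_out tgt o s1) s2 = put_out tgt o (s1 ++ s2).
Proof. by case: tgt => [v|] //=; rewrite catA. Qed.

Lemma put_store_nil tgt sg : put_store tgt sg [::] =1 sg.
Proof. by case: tgt => [v|] //= w; rewrite /upd addn0; case: eqP => // ->. Qed.

Lemma put_out_nil tgt o : put_out tgt o [::] = o.
Proof. by case: tgt => [v|] //=; rewrite cats0. Qed.

Lemma put_store_other tgt sg s w : tgt != Some w -> put_store tgt sg s w = sg w.
Proof.
case: tgt => [v|] //= ne; apply: upd_other.
by apply: contraNneq ne => ->.
Qed.

Lemma put_store_upd tgt sg s v i : tgt != Some v ->
  put_store tgt (upd sg v i) s =1 upd (put_store tgt sg s) v i.
Proof.
case: tgt => [w|] //= ne u; rewrite /upd.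
have /negbTE ne' : w != v by apply: contraNneq ne => ->.
by rewrite ne'; case: (u =P w) => [->|_] //; rewrite ne'.
Qed.

Lemma fits_put tgt sg o k k' s : size s + k' <= k -> fits sg o k ->
  fits (put_store tgt sg s) (put_out tgt o s) k'.
Proof.
move=> l [h1 h2]; split=> [w|].
  by have := put_store_le tgt sg s w; have := h1 w; lia.
by have := put_out_le tgt o s; lia.
Qed.

Lemma goes_code_emit tgt s a sg o : code_at a (code_emit tgt s a) ->
  fits sg o (size s) ->
  goes a sg o (size s) (a + size s) (put_store tgt sg s) (put_out tgt o s).
Proof.
elim: s a sg o => [|b s IH] a sg o /=.
  move=> _ _; rewrite addn0 put_out_nil; apply: goes_refl => w.
  by rewrite put_store_nil.
move=> /code_at_cons[ha hi hc] hf; rewrite -addSnnS -addn1 addnC.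
have hf' : fits (put_store tgt sg [:: b]) (put_out tgt o [:: b]) (size s).
  by apply: fits_put hf.
have := IH _ _ _ hc hf'; rewrite put_out_cat => {}IH.
apply: goes_eqr (put_store_cat tgt sg [:: b] s) _.
apply: goes_trans IH; case: tgt hi {hc hf'} => [w|] /= hi.
  by rewrite addn1; apply: goes_inc hi _ => //; have := hf.1 w; lia.
by rewrite cats1; apply: goes_emit hi _ => //; have := hf.2; lia.
Qed.

Lemma fits_leq sg o k k' : k' <= k -> fits sg o k -> fits sg o k'.
Proof. by move=> l [h1 h2]; split=> [w|]; [have := h1 w|]; lia. Qed.

(** The final store differs from [sg] at most in the target, which does not occur in [E]; so the
    bound variables, zero on entry, are zero on exit. This is what allows code to be sequenced and
    repeated. *)
Definition compiles E := forall tgt a sg o,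
  {in bound E, forall v, sg v = 0} ->
  {in vars E, forall w, tgt != Some w} ->
  code_at a (code E tgt a) -> fits sg o (cost x E sg) ->
  goes a sg o (cost x E sg) (a + len E) (put_store tgt sg (sem x E sg))
    (put_out tgt o (sem x E sg)).

Lemma compiles_cat E1 E2 : compiles E1 -> compiles E2 -> compiles (Cat E1 E2).
Proof.
move=> IH1 IH2 tgt a sg o /= hb ht /code_at_cat[hc1 hc2] hf.
rewrite size_code in hc2.
have s1 := size_sem x E1 sg.
have e2 : {in vars E2, put_store tgt sg (sem x E1 sg) =1 sg}.
  by move=> w hw; apply: put_store_other; apply: ht; rewrite mem_cat hw orbT.
have [es ec] := eq_in_sem x e2.
have := IH2 tgt _ (put_store tgt sg (sem x E1 sg)) (put_out tgt o (sem x E1 sg)) _ _ hc2.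
rewrite ec es put_out_cat addnA => {}IH2.
apply: goes_eqr (put_store_cat tgt sg _ _) _.
apply: goes_trans (IH2 _ _ _).
- apply: IH1 => //.
  + by move=> w hw; apply: hb; rewrite mem_cat hw.
  + by move=> w hw; apply: ht; rewrite mem_cat hw.
  + by apply: fits_leq hf; rewrite leq_addr.
- move=> w hw; rewrite e2 ?bound_vars //.
  by apply: hb; rewrite mem_cat hw orbT.
- by move=> w hw; apply: ht; rewrite mem_cat hw orbT.
- by apply: fits_put hf; rewrite leq_add2r.
Qed.

Lemma compiles_let v E1 E2 : v \notin vars E1 -> v \notin bound E2 ->
  compiles E1 -> compiles E2 -> compiles (Let v E1 E2).
Proof.
move=> v1 v2 IH1 IH2 tgt a sg o /= hb ht /code_at_cat[hc1 /code_at_cat[hc2 hc3]] hf.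
rewrite !size_code in hc2 hc3; have [ha hi _] := code_at_cons hc3.
have s1 := size_sem x E1 sg; set sg1 := upd sg v (size (sem x E1 sg)).
have s2 := size_sem x E2 sg1.
have v0 : sg v = 0 by apply: hb; rewrite inE eqxx.
have tv : tgt != Some v by apply: ht; rewrite inE eqxx.
(* Since [v] starts at zero, incrementing it once per bit emitted leaves exactly the length of the
   output. *)
have e1 : put_store (Some v) sg (sem x E1 sg) =1 sg1.
  by move=> w; rewrite /= v0.
have hf1 : fits sg1 o (cost x E2 sg1 + 1).
  case: hf => h1 h2; split=> [w|]; last by move: h2; rewrite -/sg1; lia.
  by have := h1 w; rewrite -/sg1 {2}/sg1 /upd; case: eqP => _; lia.
have g1 : goes a sg o (cost x E1 sg) (a + len E1) sg1 o.
  apply: goes_eqr e1 _; apply: IH1 => //.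
  + by move=> w hw; apply: hb; rewrite inE mem_cat hw orbT.
  + by move=> w hw; apply: contraNneq v1 => -[->].
  + by apply: fits_leq hf; rewrite -addnA leq_addr.
have g2 : goes (a + len E1) sg1 o (cost x E2 sg1) (a + len E1 + len E2)
    (put_store tgt sg1 (sem x E2 sg1)) (put_out tgt o (sem x E2 sg1)).
  apply: IH2 => //.
  + move=> w hw; rewrite /sg1 upd_other; first by apply: hb; rewrite inE mem_cat hw !orbT.
    by apply: contraNneq v2 => <-.
  + by move=> w hw; apply: ht; rewrite inE mem_cat hw !orbT.
  + by apply: fits_leq hf1; rewrite leq_addr.
have e2 w : upd (put_store tgt sg1 (sem x E2 sg1)) v 0 w = put_store tgt sg (sem x E2 sg1) w.
  rewrite /upd; case: eqP => [->|/eqP ne]; first by rewrite put_store_other.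
  by rewrite put_store_upd // upd_other.
apply: goes_trans (goes_trans g1 g2) _; apply: goes_eqr e2 _.
apply: goes_clr hi _ => //.
by have := (@fits_put tgt _ _ _ 1 (sem x E2 sg1) (leq_add s2 (leqnn 1)) hf1).1 v; lia.
Qed.

Lemma compiles_ifin v E1 E2 :
  compiles E1 -> compiles E2 -> compiles (IfIn v E1 E2).
Proof.
move=> IH1 IH2 tgt a sg o /= hb ht /code_at_cons[ha hi /code_at_cat[hc1]].
rewrite size_code => /code_at_cons[ha' hi' hc2] hf.
have hv : sg v <= B by have := hf.1 v; lia.
have := goes_in (sg := sg) (o := o) ha hi hv.
case: (nth false x (sg v)) hf => hf g.
- have g1 : goes a.+1 sg o (cost x E1 sg) (a.+1 + len E1)
      (put_store tgt sg (sem x E1 sg)) (put_out tgt o (sem x E1 sg)).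
    apply: IH1 => //.
    + by move=> w hw; apply: hb; rewrite mem_cat hw.
    + by move=> w hw; apply: ht; rewrite inE mem_cat hw orbT.
    + by apply: fits_leq hf; rewrite leq_addr.
  rewrite (_ : cost x E1 sg + 2 = 1 + cost x E1 sg + 1); last by lia.
  exact: goes_trans (goes_trans g g1) (goes_nop ha' hi').
- have g2 : goes (a.+2 + len E1) sg o (cost x E2 sg) (a + (len E1 + len E2 + 2))
      (put_store tgt sg (sem x E2 sg)) (put_out tgt o (sem x E2 sg)).
    rewrite (_ : a + _ = a.+2 + len E1 + len E2); last by lia.
    apply: IH2 => //.
    + by move=> w hw; apply: hb; rewrite mem_cat hw orbT.
    + by move=> w hw; apply: ht; rewrite inE mem_cat hw !orbT.
    + by apply: fits_leq hf; rewrite leq_addr.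
  (* Only the first branch needs the jump over the other one, so here one sweep is left over. *)
  apply: goes_leq (goes_trans g g2); lia.
Qed.

Lemma compiles_for v u E : v != u -> v \notin bound E -> u \notin bound E ->
  compiles E -> compiles (For v u E).
Proof.
move=> vu vE uE IH tgt a sg o /= hb ht /code_at_cons[ha hi /code_at_cat[hc]].
rewrite size_code => /code_at_cons[ha1 hi1 /code_at_cons[ha2 hi2 _]] hf.
have v0 : sg v = 0 by apply: hb; rewrite inE eqxx.
have tv : tgt != Some v by apply: ht; rewrite inE eqxx.
have tu : tgt != Some u by apply: ht; rewrite !inE eqxx orbT.
pose out i := flatten [seq sem x E (upd sg v j) | j <- iota 0 i].
pose cst i := \sum_(0 <= j < i) (cost x E (upd sg v j) + 2).
have outS i : out i.+1 = out i ++ sem x E (upd sg v i).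
  by rewrite /out -addn1 iotaD map_cat flatten_cat /= cats0.
have cstS i : cst i.+1 = cst i + (cost x E (upd sg v i) + 2).
  by rewrite /cst big_nat_recr.
have size_out i : size (out i) <= cst i.
  elim: i => [|i IHi] //; rewrite outS cstS size_cat leq_add //.
  exact: leq_trans (size_sem _ _ _) (leq_addr _ _).
have cst_mono i : i <= sg u -> cst i <= cst (sg u).
  by move=> l; rewrite [cst (sg u)](big_cat_nat (n := i)) //= leq_addr.
(* Loop invariant at the test: [i] rounds have been emitted and paid for, and the index counter
   holds [i]. *)
have loop i : i <= sg u ->
    goes a sg o (cst i) a (upd (put_store tgt sg (out i)) v i) (put_out tgt o (out i)).
  elim: i => [|i IHi] hi'.
    rewrite /cst big_geq // put_out_nil; apply: goes_refl => w.
    by rewrite /upd; case: eqP => [->//|_]; rewrite put_store_nil.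
  rewrite cstS outS; apply: goes_trans (IHi (ltnW hi')) _.
  set s := put_store tgt sg (out i); set o' := put_out tgt o (out i).
  have hcst := cst_mono _ hi'; rewrite cstS in hcst.
  have hout := size_out i.
  have hfi : fits (upd s v i) o' (cost x E (upd sg v i) + 2).
    have [h1 h2] := fits_put tgt (s := out i) (k' := cost x E (upd sg v i) + 2)
      (leq_trans (leq_add hout (leqnn _)) (leq_trans hcst (leq_addr _ _))) hf.
    split=> // w; have [->|wv] := eqVneq w v; last by rewrite upd_other.
    (* The index stays below the limit, so it inherits its room from the counter [u]. *)
    rewrite upd_same; have : sg u + (cst (sg u) + 2) <= B := hf.1 u; lia.
  have e1 : {in vars E, upd s v i =1 upd sg v i}.
    move=> w hw; rewrite /upd; case: eqP => // _; apply: put_store_other.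
    by apply: ht; rewrite !inE hw !orbT.
  have [es ec] := eq_in_sem x e1.
  have hvi : upd s v i v <= B by have := hfi.1 v; lia.
  have gt := goes_lt (o := o') ha hi hvi.
  rewrite upd_same upd_other ?[u == v]eq_sym // in gt.
  rewrite [s u]put_store_other // hi' in gt.
  have gb : goes a.+1 (upd s v i) o' (cost x E (upd sg v i)) (a.+1 + len E)
      (put_store tgt (upd s v i) (sem x E (upd sg v i)))
      (put_out tgt o' (sem x E (upd sg v i))).
    rewrite -es -ec; apply: IH => //.
    + move=> w hw; rewrite e1 ?bound_vars // upd_other.
        by apply: hb; rewrite inE hw orbT.
      by apply: contraNneq vE => <-.
    + by move=> w hw; apply: ht; rewrite !inE hw !orbT.
    + by rewrite ec; apply: fits_leq hfi; rewrite leq_addr.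
  set s2 := put_store _ _ _ in gb; set o2 := put_out _ _ _ in gb.
  have s2v : s2 v = i by rewrite /s2 put_store_other // upd_same.
  have hs2 : s2 v <= B by rewrite s2v -(upd_same s v i).
  have gi := goes_inc (o := o2) ha1 hi1 hs2.
  have := goes_trans (goes_trans gt gb) gi.
  rewrite (_ : 1 + _ + 1 = cost x E (upd sg v i) + 2); last by lia.
  rewrite /o2 put_out_cat; apply: goes_eqr => w.
  rewrite s2v /upd; case: eqP => // /eqP wv; rewrite /s2 put_store_upd // upd_other //.
  exact: put_store_cat.
have := loop _ (leqnn _).
set s := upd _ _ _; set o' := put_out _ _ _ => gl.
have sv : s v = sg u by rewrite /s upd_same.
have hsv : s v <= B by rewrite sv; have := hf.1 u; lia.
have gt := goes_lt (o := o') ha hi hsv.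
rewrite sv [s u]upd_other ?[u == v]eq_sym // put_store_other // ltnn in gt.
rewrite (_ : a.+2 + len E = (a.+1 + len E).+1) // in gt.
have gc := goes_clr (o := o') ha2 hi2 hsv.
have := goes_trans gl (goes_trans gt gc); rewrite -/(cst _).
apply: goes_eqr => w; rewrite /upd; case: eqP => [->|/eqP wv].
  by rewrite put_store_other.
by rewrite /s upd_other.
Qed.

Lemma wf_compiles E : wf E -> compiles E.
Proof.
elim: E => [s|E1 IH1 E2 IH2|v u E IH|v E1 IH1 E2 IH2|v E1 IH1 E2 IH2] /=.
- by move=> _ tgt a sg o _ _ hc hf; apply: goes_code_emit.
- by move=> /andP[w1 w2]; apply: compiles_cat; auto.
- by move=> /and4P[? ? ? w]; apply: compiles_for; auto.
- by move=> /and4P[? ? w1 w2]; apply: compiles_let; auto.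
- by move=> /andP[w1 w2]; apply: compiles_ifin; auto.
Qed.

End Compile.
End LoopPrograms.

(** * Polynomial bounds for loop programs *)

Lemma add_expn_le n x y a b :
  x <= n.+2 ^ a -> y <= n.+2 ^ b -> x + y <= n.+2 ^ (a + b + 1).
Proof.
move=> hx hy; rewrite expnD expn1 expnD.
have := expn_gt0 n.+2 a; have := expn_gt0 n.+2 b; rewrite /=.
by set A := n.+2 ^ a in hx *; set B := n.+2 ^ b in hy *; nia.
Qed.

Lemma mul_expn_le n x y a b :
  x <= n.+2 ^ a -> y <= n.+2 ^ b -> x * y <= n.+2 ^ (a + b).
Proof. by move=> hx hy; rewrite expnD leq_mul. Qed.

Lemma const_expn_le n c : c <= n.+2 ^ c.
Proof. by apply: ltnW; apply: ltn_expl. Qed.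

(** For positive n, n + 2 is at most 3 n; for n = 0 the additive constant suffices. *)
Lemma expn_le_polyb n c : n.+2 ^ c <= polyb (3 ^ c) c n.
Proof.
rewrite /polyb; case: n => [|n].
  by case: c => // c; apply: leq_trans (leq_addl _ _); rewrite leq_exp2r.
apply: leq_trans (leq_addr _ _); rewrite -expnMn.
by case: c => // c; rewrite leq_exp2r //; lia.
Qed.

Section CostBound.
Variable V : finType.

(** Pure powers of [m.+2] are convenient because the base is at least 2: sums, products and
    constants are again bounded by such powers, without coefficients. A loop index stays below [m],
    so loops keep the same base. *)
Lemma cost_bound (E : prog V) : exists c, forall x (sg : V -> nat) m,
  (forall v, sg v <= m) -> cost x E sg <= m.+2 ^ c.
Proof.
elim: E => [s|E1 [a h1] E2 [b h2]|v u E [a h]|v E1 [a h1] E2 [b h2]|v E1 [a h1] E2 [b h2]].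
- by exists (size s) => x sg m _; apply: const_expn_le.
- by exists (a + b + 1) => x sg m hm; apply: add_expn_le; [apply: h1 | apply: h2].
- exists ((1 + (a + 2 + 1)) + 2 + 1) => x sg m hm /=; apply: add_expn_le (const_expn_le _ _).
  have l : \sum_(0 <= i < sg u) (cost x E (upd sg v i) + 2) <= m * (m.+2 ^ (a + 2 + 1)).
    apply: leq_trans (_ : \sum_(0 <= i < sg u) m.+2 ^ (a + 2 + 1) <= _); last first.
      by rewrite sum_nat_const_nat subn0 leq_mul2r hm orbT.
    rewrite !big_nat; apply: leq_sum => i /andP[_ hi].
    apply: add_expn_le (const_expn_le _ _); apply: h => w.
    by rewrite /upd; case: eqP => // _; have := hm u; lia.
  by apply: leq_trans l _; apply: mul_expn_le => //; rewrite expn1; lia.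
- exists (a + ((1 + a + 1) + 1 + 1) * b + 1 + 1 + 1) => x sg m hm /=.
  apply: add_expn_le; last exact: const_expn_le 1.
  apply: add_expn_le; first exact: h1.
  (* The counted length can be as large as the cost of [E1], so [E2] runs with stores bounded by
     [m + m.+2 ^ a]. The new base is itself a power of [m.+2], and the exponents multiply. *)
  have hn : m + m.+2 ^ a + 2 <= m.+2 ^ (1 + a + 1 + 1 + 1).
    rewrite (_ : m + _ + 2 = m.+2 + m.+2 ^ a); last by lia.
    have l1 : m.+2 + m.+2 ^ a <= m.+2 ^ (1 + a + 1) by apply: add_expn_le; rewrite ?expn1.
    by apply: leq_trans l1 _; rewrite leq_exp2l //; lia.
  rewrite expnM; apply: leq_trans (h2 x _ (m + m.+2 ^ a) _) _.
    move=> w; rewrite /upd; case: eqP => _; last exact: leq_trans (hm w) (leq_addr _ _).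
    by apply: leq_trans (size_sem _ _ _) (leq_trans (h1 _ _ _ hm) (leq_addl _ _)).
  by case: b {h2} => // b; rewrite leq_exp2r // -addn2.
- exists (a + b + 1 + 2 + 1) => x sg m hm /=; apply: add_expn_le (const_expn_le _ _).
  apply: leq_trans (_ : m.+2 ^ a + m.+2 ^ b <= _); last exact: add_expn_le.
  by have := h1 x sg m hm; have := h2 x sg m hm; case: ifP => _; lia.
Qed.

Variables (n0 : V) (E : prog V).

Definition input_store (x : seq bool) : V -> nat := upd (fun=> 0) n0 (size x).

Definition loop_machine := sweep_machine ((len_op n0, 1, 1) :: code E None 1).

Hypotheses (wfE : wf E) (n0E : n0 \notin bound E).

(** One step flags cell 0, one sweep stores the input length, and [K] sweeps run the program.
    Counters start at [size x] or 0 and the output is empty, so none of them exceeds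
    [size x + K]. *)
Lemma loop_machine_computes x :
  let K := cost x E (input_store x) in
  computes_within loop_machine x (1 + (1 + K) * ((size x + K).*2 + 2))
    (sem x E (input_store x)).
Proof.
move=> K; set B := size x + K; rewrite /loop_machine; set pr := _ :: _.
set M := sweep_machine pr.
have h0 : represents (init_config M x) (tm_start M) 0
    (fun i => nth (tm_blank M) (map (tm_in M) x) i) by apply: represents_init.
have h1 : @at_label _ pr (step (init_config M x)) 0 (tape x (fun=> 0) [::]).
  have := @represents_step M _ _ _ _ ((inord 0, scan) : tm_state M)
    (set_end (nth (tm_blank M) (map (tm_in M) x) 0)) Stay h0.
  rewrite not_scan_running // => /(_ isT) H.
  apply: eq_represents (H _ _) => // [i|]; last first.
    by rewrite /= (_ : ord0 = inord 0) //; apply/val_inj; rewrite /= inordK.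
  have e0 : [ffun=> false] = [ffun v : V => i < 0] by apply/ffunP => v; rewrite !ffunE.
  rewrite /upd /tape onth0n -e0; case: eqP => [->|/eqP/negbTE ne].
    by case: (x).
  case: (ltnP i (size x)) => hi; last first.
    by rewrite nth_default ?size_map // onth_default // ne.
  by rewrite (nth_map false) // onthE (nth_map false) // ne.
have g1 : @goes V x pr B 0 (fun=> 0) [::] 1 1 (input_store x) [::].
  by rewrite /input_store; apply: (@goes_len _ _ _ _ 0 1 1) => //; apply: leq_addr.
have g2 : @goes V x pr B 1 (input_store x) [::] K (1 + len E) (input_store x)
    (sem x E (input_store x)).
  apply: (@wf_compiles V x pr B E wfE None) => //.
  - by move=> v hv; rewrite /input_store upd_other //; apply: contraNneq n0E => <-.
  - by exists [:: (len_op n0, 1, 1)], [::]; rewrite cats0.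
  - split=> [w|]; last by rewrite add0n leq_addl.
    by rewrite leq_add2r /input_store /upd; case: eqP.
have [t ht hat] := goes_trans g1 g2 h1.
have sz : size pr = 1 + len E by rewrite /= size_code.
have hh : tm_halt M (cstate (run M (1 + t) x)).
  rewrite addnC /run iterD (represents_state hat); apply/andP; split=> //.
  by rewrite -[X in inord X]sz /= inordK.
rewrite /computes_within /halts_within.
have -> : run M (1 + (1 + K) * (B.*2 + 2)) x = run M (1 + t) x.
  rewrite -(subnK (_ : 1 + t <= 1 + (1 + K) * (B.*2 + 2))) ?leq_add2l //.
  by rewrite {1}/run iterD; apply: iter_step_halted.
split; first exact: hh.
by rewrite /run addnC iterD; apply: (coutput_represents hat).
Qed.

Theorem loop_program_poly : exists (M : TM) (c k : nat), forall x,
  computes_within M x (polyb c k (size x)) (sem x E (input_store x)).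
Proof.
have [a ha] := cost_bound E.
(* The exponent follows the shape of the time bound: exponents add up over sums and products, with
   an extra 1 for each sum. *)
pose d := 1 + (1 + a + 1 + (1 + a + 1 + (1 + a + 1) + 1 + 2 + 1)) + 1.
exists loop_machine, (3 ^ d), d => x.
have [hh ho] := loop_machine_computes x; move: hh ho.
set K := cost _ _ _; set T := 1 + _ => hh ho.
have hK : K <= (size x).+2 ^ a by apply: ha => v; rewrite /input_store /upd; case: eqP.
suff hT : T <= polyb (3 ^ d) d (size x).
  rewrite /computes_within /halts_within /run -(subnK hT) iterD.
  by rewrite iter_step_halted.
apply: leq_trans (expn_le_polyb _ _).
apply: add_expn_le; first exact: const_expn_le.
apply: mul_expn_le; first by apply: add_expn_le => //; apply: const_expn_le.
apply: add_expn_le; last exact: const_expn_le.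
rewrite -addnn; apply: add_expn_le; apply: add_expn_le => //; rewrite expn1; lia.
Qed.

End CostBound.

(** * Words and their encoding *)

Section Encoding.

(** Letters carry plain numbers, so that words can be built and printed independently of the number
    of generators; a bound on the letters is restored in [EPI_wenc]. *)
Definition letter := (nat * bool)%type.
Definition word := seq letter.

Definition unary (k : nat) : seq bool := flatten (nseq k tokU).
Definition wenc_letter (l : letter) := unary l.1 ++ (if l.2 then tokLn else tokLp).
Definition wenc_word (w : word) := flatten (map wenc_letter w) ++ tokW.
Definition wenc_rels (rs : seq word) := flatten (map wenc_word rs).
Definition wenc (m : nat) (rs : seq word) := unary m ++ tokW ++ wenc_rels rs.

(** The unary digit is the only token with both bits false, so any other token ends a run of digits
    unambiguously. *)
Lemma unary_token_inj k k' a b a' b' s s' :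
  a || b -> a' || b' ->
  unary k ++ [:: a, b & s] = unary k' ++ [:: a', b' & s'] ->
  [/\ k = k', a = a', b = b' & s = s'].
Proof.
move=> hab hab'; elim: k k' => [|k IH] [|k'] //=.
- by case=> -> -> ->.
- by case=> ha hb _; rewrite ha hb in hab.
- by case=> ha hb _; rewrite -ha -hb in hab'.
- by case=> /IH[-> -> -> ->].
Qed.

Lemma wenc_word_inj w w' s s' :
  wenc_word w ++ s = wenc_word w' ++ s' -> w = w' /\ s = s'.
Proof.
rewrite /wenc_word -!catA; elim: w w' => [|[i e] w IH] [|[i' e'] w'] /=; rewrite -?catA.
- by case.
- by case: e' => /= /(@unary_token_inj 0 i')[].
- by case: e => /= /(@unary_token_inj i 0)[].
- rewrite /wenc_letter /= -?catA.
  by case: e => /=; case: e' => /= /unary_token_inj[] // -> ? _ /IH[-> ->].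
Qed.

(** [EPI] quantifies over all presentations with a given code; injectivity excludes that a different
    presentation with that code has an epimorphism. *)
Lemma wenc_inj m m' rs rs' : wenc m rs = wenc m' rs' -> m = m' /\ rs = rs'.
Proof.
move=> /unary_token_inj[] // -> _ _ e; split=> //; move: e.
have ne w s : wenc_word w ++ s <> [::].
  by move/(congr1 size); rewrite !size_cat /= addn2.
rewrite /wenc_rels; elim: rs rs' => [|w rs IH] [|w' rs'] //=.
- by move/esym/ne.
- by move/ne.
- by move/wenc_word_inj => [-> /IH ->].
Qed.

Section Eval.
Variable gT : finGroupType.
Local Open Scope group_scope.

Definition weval (f : nat -> gT) (w : word) : gT :=
  \prod_(l <- w) (if l.2 then (f l.1)^-1 else f l.1).

Definition raw_rels (P : presentation) : seq word :=
  [seq [seq (val l.1, l.2) | l <- r] | r <- pr_rels P].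

Lemma enc_raw P : enc_presentation P = wenc (pr_ngens P) (raw_rels P).
Proof.
rewrite /enc_presentation /wenc /wenc_rels /raw_rels -map_comp.
congr (_ ++ (_ ++ flatten _)); apply: eq_map => r /=.
by rewrite /enc_word /wenc_word -map_comp.
Qed.

Definition word_epi (H : {set gT}) (m : nat) (rs : seq word) : Prop :=
  exists f : nat -> gT,
    [/\ forall i, i < m -> f i \in H, forall r, r \in rs -> weval f r = 1
      & <<[set f (val i) | i : 'I_m]>> = H].

Lemma has_epi_raw (H : {group gT}) P :
  has_epi H P <-> word_epi H (pr_ngens P) (raw_rels P).
Proof.
split=> [] [f [fH fR fG]].
- pose f' i := if insub i is Some o then f o else 1.
  have f'E (o : 'I_(pr_ngens P)) : f' (val o) = f o by rewrite /f' valK.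
  exists f'; split.
  + by move=> i hi; rewrite -[i]/(val (Ordinal hi)) f'E.
  + move=> _ /mapP[r hr ->]; rewrite -(fR r hr) /weval /eval_word big_map.
    by apply: eq_bigr => l _; rewrite f'E.
  + by rewrite -fG; congr <<_>>; apply: eq_imset => o; rewrite f'E.
- exists (fun o => f (val o)); split=> //.
  + by move=> o; apply: fH; apply: ltn_ord.
  + move=> r hr; rewrite -(fR [seq (val l.1, l.2) | l <- r]); last by apply: map_f.
    by rewrite /weval /eval_word big_map.
Qed.

Lemma EPI_wenc (H : {group gT}) m (rs : seq word) :
  all (all (fun l => l.1 < m.+1)) rs ->
  EPI H (wenc m.+1 rs) <-> word_epi H m.+1 rs.
Proof.
move=> hb; split=> [[P [e /has_epi_raw]]|he].
  by move: e; rewrite enc_raw => /wenc_inj[<- <-].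
pose P := @Presentation m.+1 [seq [seq (inord l.1 : 'I_m.+1, l.2) | l <- r] | r <- rs].
have e : raw_rels P = rs.
  rewrite /raw_rels /P /= -map_comp -[RHS]map_id; apply/eq_in_map => r hr /=.
  rewrite -map_comp -[RHS]map_id; apply/eq_in_map => -[i b] hl /=.
  by rewrite inordK //; apply: (allP (allP hb r hr) (i, b)).
by exists P; rewrite enc_raw has_epi_raw e.
Qed.

End Eval.
End Encoding.

(** * Clauses in dihedral groups *)

Section DihedralLike.
Variables (gT : finGroupType) (R : {group gT}).
Local Open Scope group_scope.

Hypothesis cosetR : forall g h : gT, g \notin R -> h \notin R -> g * h \in R.
Hypothesis involR : forall g : gT, g \notin R -> g * g = 1.
Hypothesis invertR : forall u g : gT, u \in R -> g \notin R -> u ^ g = u^-1.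
Hypothesis abelR : abelian R.

Lemma commuteR u v : u \in R -> v \in R -> commute u v.
Proof. by move=> hu hv; apply: (centsP abelR). Qed.

Lemma invR g : g \notin R -> g^-1 = g.
Proof. by move=> hg; apply/eqP; rewrite eq_invg_mul involR. Qed.

Lemma swapR u g : u \in R -> g \notin R -> g * u = u^-1 * g.
Proof. by move=> hu hg; rewrite -(invertR hu hg) conjgE invR // -!mulgA involR // mulg1. Qed.

Lemma commg_rotation u g : u \in R -> g \notin R -> [~ u, g] = (u ^+ 2)^-1.
Proof. by move=> hu hg; rewrite commgEl invertR // -invMg. Qed.

(** A commutator with a reflection replaces a rotation by the inverse of its square, so every entry
    doubles the exponent up to sign. *)
Lemma foldl_commg_rotation v ls : v \in R -> all [predC R] ls ->
  foldl commg v ls = 1 -> v ^+ (2 ^ size ls) = 1.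
Proof.
elim: ls v => [|l ls IH] v hv /=; first by rewrite expg1.
move=> /andP[hl hls]; rewrite commg_rotation // => /IH.
rewrite groupV groupX // => /(_ isT hls)/eqP.
by rewrite expgVn eq_invg1 -expgM expnS => /eqP.
Qed.

Lemma torsion_of_commutator (A : {set gT}) a l ls x :
  {in A, forall g, g * g = 1} -> {in A, forall g, g \notin R -> commute l g} ->
  l \notin R -> all [predC R] ls ->
  foldl commg a (l :: ls) = 1 -> <<a |: A>> = [set: gT] ->
  x \in R -> x ^+ (2 ^ (size ls).+1) = 1.
Proof.
move=> A2 AC lR lsR /= hc hG hx.
set K := (2 ^ _)%N; have K2 (g : gT) : g * g = 1 -> g ^+ K = 1.
  by move=> hg; rewrite /K expnS expgM (expgS g 1) expg1 hg expg1n.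
(* The rotation part of [g] relative to [l]. In all four cases below, the rotation part of g h is
   the product of that of h with that of g or its inverse; as rotations commute, [S] is closed under
   products. *)
pose proj (g : gT) : gT := if g \in R then g else l * g.
have projR g : proj g \in R by rewrite /proj; case: ifPn => // hg; apply: cosetR.
pose S := [set g | proj g ^+ K == 1].
have XM (u v : gT) : u \in R -> v \in R -> u ^+ K = 1 -> v ^+ K = 1 -> (u * v) ^+ K = 1.
  by move=> hu hv eu ev; rewrite expgMn ?eu ?ev ?mulg1 //; apply: commuteR.
have XV (u : gT) : u ^+ K = 1 -> u^-1 ^+ K = 1 by move=> eu; rewrite expgVn eu invg1.
have gS : group_set S.
  apply/group_setP; split=> [|g h]; first by rewrite inE /proj group1 expg1n.
  rewrite !inE => /eqP hg /eqP hh; apply/eqP.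
  have hgR := projR g; have hhR := projR h; move: hg hh hgR hhR; rewrite /proj.
  case: (boolP (g \in R)) => gR; case: (boolP (h \in R)) => hR hg hh hgR hhR.
  - by rewrite groupM //; apply: XM.
  - rewrite groupMl // (negbTE hR) mulgA (swapR gR lR) -mulgA; apply: XM => //.
      by rewrite groupV.
    exact: XV.
  - by rewrite groupMr // (negbTE gR) mulgA; apply: XM.
  - rewrite cosetR // (_ : g * h = (l * g)^-1 * (l * h)); last first.
      by rewrite invMg !invR // -mulgA (mulgA l l) involR // mul1g.
    by apply: XM; rewrite ?groupV //; apply: XV.
have a_ok : proj a ^+ K = 1.
  rewrite /proj; case: ifPn => aR.
    move: hc; rewrite commg_rotation // => /foldl_commg_rotation.
    rewrite groupV groupX // => /(_ isT lsR)/eqP.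
    by rewrite expgVn eq_invg1 -expgM -expnS => /eqP.
  have laR : l * a \in R by apply: cosetR.
  (* For two involutions [a, l] = a l a l, so also when [a] is a reflection the first commutator is
     the inverse square of its rotation part. *)
  have e : [~ a, l] = ((l * a) ^+ 2)^-1.
    by rewrite commgEl conjgE (expgS _ 1) expg1 !invMg (invR aR) (invR lR) !mulgA.
  move: hc; rewrite e => /foldl_commg_rotation.
  rewrite groupV groupX // => /(_ isT lsR)/eqP.
  by rewrite expgVn eq_invg1 -expgM -expnS => /eqP.
have sub : a |: A \subset S.
  apply/subsetP => g; rewrite !inE => /orP[/eqP->|gA]; first exact/eqP.
  (* It is enough that the rotation part squares to 1, since [K] is even. For a reflection in [A],
     it is a product of two commuting involutions. *)
  apply/eqP/K2; rewrite /proj; case: ifPn => gR; first exact: A2.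
  by rewrite -mulgA (mulgA g l) -(AC g gA gR) -!mulgA A2 // mulg1 involR.
have sS : <<a |: A>> \subset Group gS by rewrite gen_subG.
have := subsetP sS x; rewrite hG inE => /(_ isT).
by rewrite inE /proj hx => /eqP.
Qed.

End DihedralLike.

Section Words.

Definition ltr (i : nat) : word := [:: (i, false)].
(** Polymorphic in the letters, because the printing program forms the same commutators from
    symbolic letters whose indices are known only at run time. *)
Definition winv (A : Type) (w : seq (A * bool)) := rev [seq (l.1, ~~ l.2) | l <- w].
Definition wcomm (A : Type) (u v : seq (A * bool)) := winv u ++ winv v ++ u ++ v.

(* Generators: 0 is a reflection s, 1 is a rotation a, and i + 2 stands for the
   Boolean variable i, which is true when its image is a reflection. *)
Definition wlit (p : nat * bool) : word :=
  if p.2 then ltr p.1.+2 else ltr 0 ++ ltr p.1.+2.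

(* Trivial in the intended images as soon as some [val p.1] differs from [p.2]. *)
Definition wclause (cl : seq (nat * bool)) : word := foldl (@wcomm nat) (ltr 1) (map wlit cl).

Definition var_rels i : seq word :=
  [:: ltr i.+2 ++ ltr i.+2; wcomm (ltr 0) (ltr i.+2); wclause [:: (i, true); (i, false)]].
Definition pair_rel i j : word := wcomm (ltr i.+2) (ltr j.+2).

Definition base_rels N : seq word :=
  (ltr 0 ++ ltr 0) :: flatten [seq var_rels i | i <- iota 0 N] ++
  flatten [seq [seq pair_rel i j | j <- iota 0 N] | i <- iota 0 N].

Section Eval.
Variables (gT : finGroupType) (f : nat -> gT).
Local Open Scope group_scope.

Lemma weval_cat u v : weval f (u ++ v) = weval f u * weval f v.
Proof. exact: big_cat. Qed.

Lemma weval_ltr i : weval f (ltr i) = f i.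
Proof. by rewrite /weval big_seq1. Qed.

Lemma weval_inv w : weval f (winv w) = (weval f w)^-1.
Proof.
elim: w => [|[i e] w IH]; first by rewrite /weval !big_nil invg1.
rewrite /winv /= rev_cons -cats1 weval_cat -/(winv w) IH.
rewrite -[in RHS]cat1s weval_cat invMg; congr (_ * _).
by rewrite /weval !big_seq1; case: e => //=; rewrite invgK.
Qed.

Lemma weval_comm u v : weval f (wcomm u v) = [~ weval f u, weval f v].
Proof. by rewrite !weval_cat !weval_inv commgEl conjgE !mulgA. Qed.

Definition glit (p : nat * bool) : gT := if p.2 then f p.1.+2 else f 0 * f p.1.+2.

Lemma weval_clause cl : weval f (wclause cl) = foldl commg (f 1) (map glit cl).
Proof.
rewrite /wclause -(weval_ltr 1); elim: cl (ltr 1) => //= p cl IH w.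
rewrite IH weval_comm; congr (foldl commg [~ _, _] _).
by rewrite /wlit /glit; case: p.2; rewrite ?weval_cat !weval_ltr.
Qed.

Lemma base_relsP N :
  (forall r, r \in base_rels N -> weval f r = 1) <->
  [/\ f 0 * f 0 = 1,
      forall i, i < N -> [/\ f i.+2 * f i.+2 = 1, commute (f 0) (f i.+2)
                          & [~ f 1, f i.+2, f 0 * f i.+2] = 1]
    & forall i j, i < N -> j < N -> commute (f i.+2) (f j.+2)].
Proof.
split=> [h|[h0 hv hp] r].
- have hv i r : i < N -> r \in var_rels i -> weval f r = 1.
    move=> hi hr; apply: h; rewrite inE mem_cat; apply/orP; right; apply/orP; left.
    by apply/flattenP; exists (var_rels i) => //; apply: map_f; rewrite mem_iota.
  split=> [|i hi|i j hi hj].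
  + by have := h _ (mem_head _ _); rewrite weval_cat weval_ltr.
  + split.
    * by have := hv i _ hi (mem_head _ _); rewrite weval_cat weval_ltr.
    * have := hv i (wcomm (ltr 0) (ltr i.+2)) hi; rewrite !inE eqxx orbT => /(_ isT).
      by rewrite weval_comm !weval_ltr => /eqP/commgP.
    * have := hv i (wclause [:: (i, true); (i, false)]) hi; rewrite !inE eqxx !orbT => /(_ isT).
      by rewrite weval_clause.
  + have : pair_rel i j \in base_rels N.
      rewrite inE mem_cat; apply/orP; right; apply/orP; right.
      apply/flattenP; exists [seq pair_rel i j | j <- iota 0 N].
        by apply: map_f; rewrite mem_iota.
      by apply: map_f; rewrite mem_iota.
    by move/h; rewrite weval_comm !weval_ltr => /eqP/commgP.
- rewrite inE mem_cat => /or3P[/eqP->|/flattenP[_ /mapP[i hi ->]]|/flattenP[_ /mapP[i hi ->]]].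
  + by rewrite weval_cat weval_ltr.
  + rewrite mem_iota in hi; have [h1 h2 h3] := hv i hi.
    rewrite !inE => /or3P[] /eqP->.
    * by rewrite weval_cat weval_ltr.
    * by rewrite weval_comm !weval_ltr; apply/eqP/commgP.
    * by rewrite weval_clause.
  + move=> /mapP[j hj ->]; rewrite !mem_iota in hi hj.
    by rewrite weval_comm !weval_ltr; apply/eqP/commgP/hp.
Qed.

End Eval.
End Words.

(** * Satisfying valuations and epimorphisms *)

Section Clauses.
Variables (gT : finGroupType) (R : {group gT}) (x0 y0 : gT).
Local Open Scope group_scope.

Hypothesis cosetR : forall g h : gT, g \notin R -> h \notin R -> g * h \in R.
Hypothesis involR : forall g : gT, g \notin R -> g * g = 1.
Hypothesis invertR : forall u g : gT, u \in R -> g \notin R -> u ^ g = u^-1.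
Hypothesis abelR : abelian R.
Hypothesis x0R : x0 \in R.
Hypothesis y0R : y0 \notin R.
Hypothesis x0y0 : <<[set x0; y0]>> = [set: gT].
Hypothesis x0n : forall k, x0 ^+ (2 ^ k) != 1.

Lemma solution_epi N (cls : seq (seq (nat * bool))) (val : nat -> bool) :
  all (has (fun p => val p.1 != p.2)) cls ->
  word_epi [set: gT] N.+2 (base_rels N ++ map wclause cls).
Proof.
move=> hval.
(* Every literal then evaluates to [y0] or to 1, and to 1 exactly when [val p.1 != p.2]; a single
   trivial entry kills the whole commutator. *)
pose f i := match i with 0 => y0 | 1 => x0 | i.+2 => if val i then y0 else 1 end.
have y2 : y0 * y0 = 1 by apply: involR.
have fb : forall r, r \in base_rels N -> weval f r = 1.
  apply/base_relsP; split=> //= [i hi|i j hi hj]; last first.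
    by case: (val i); case: (val j) => //; do ?[exact: commute1 | exact/commute_sym/commute1].
  case: (val i); split; rewrite ?mulg1 ?y2 ?commg1 ?comm1g //; exact: commute1.
exists f; split=> [i _|r|].
- by rewrite inE.
- rewrite mem_cat => /orP[/fb//|/mapP[cl hcl ->]]; rewrite weval_clause.
  have := allP hval cl hcl; elim: cl {hcl} (f 1%N) => //= p cl IH u.
  have one ls : foldl commg (1 : gT) ls = 1 by elim: ls => //= l ls; rewrite comm1g.
  case: eqP => [_ /IH->//|ne _].
  suff -> : glit f p = 1 by rewrite commg1 one.
  by move: ne; rewrite /glit /=; case: p => i [] /=; case: (val i).
- apply/eqP; rewrite eqEsubset subsetT -x0y0 genS //.
  apply/subsetP => g; rewrite !inE => /orP[] /eqP->.
  + by apply/imsetP; exists (Ordinal (isT : 1 < N.+2)).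
  + by apply/imsetP; exists (Ordinal (isT : 0 < N.+2)).
Qed.

Lemma epi_solution N (cls : seq (seq (nat * bool))) :
  all (fun cl => (cl != [::]) && all (fun p => p.1 < N) cl) cls ->
  word_epi [set: gT] N.+2 (base_rels N ++ map wclause cls) ->
  exists val : nat -> bool, all (has (fun p => val p.1 != p.2)) cls.
Proof.
move=> hcls [f [_ fR fG]].
have fb : forall r, r \in base_rels N -> weval f r = 1.
  by move=> r hr; apply: fR; rewrite mem_cat hr.
have [f00 fv fp] := (base_relsP f N).1 fb.
(* [D] lists s, y_0, y_1, ...; the set [A] below adds the products of s with these. It is a set of
   commuting elements with trivial square that contains all literals, and it generates the group
   together with the image of [a]. *)
pose D i := if i is 0 then f 0 else f i.+1.
have DD i j : i <= N -> j <= N -> commute (D i) (D j).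
  case: i => [|i]; case: j => [|j] // hi hj; first by case: (fv j hj).
    by apply: commute_sym; case: (fv i hi).
  exact: fp.
have D2 i : i <= N -> D i * D i = 1 by case: i => // i hi; case: (fv i hi).
pose elt (p : bool * 'I_N.+1) : gT := D 0 ^+ p.1 * D p.2.
pose A := [set elt p | p : bool * 'I_N.+1].
have pN (p : bool * 'I_N.+1) : p.2 <= N by rewrite -ltnS.
have Delt p i : i <= N -> commute (D i) (elt p).
  move=> hi; apply: commuteM; last by apply: DD.
  by apply: commuteX; apply: DD.
have AA : {in A &, forall g h, commute g h}.
  move=> _ h /imsetP[p _ ->] /imsetP[q _ ->]; apply: commute_sym; apply: commuteM.
    by apply: commuteX; apply: commute_sym; apply: Delt.
  by apply: commute_sym; apply: Delt.
have A2 : {in A, forall g, g * g = 1}.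
  move=> _ /imsetP[p _ ->]; rewrite /elt -mulgA (mulgA (D p.2)).
  have /commute_sym <- : commute (D p.2) (D 0 ^+ p.1).
    by apply: commuteX; apply: DD.
  rewrite -mulgA D2 ?pN // mulg1 -expgD.
  by case: p.1; rewrite ?expg0 // (expgS _ 1) expg1 D2.
have AD (b : bool) i : i <= N -> D 0 ^+ b * D i \in A.
  by move=> hi; apply/imsetP; exists (b, inord i); rewrite // /elt /= inordK.
have Af i : i < N -> f i.+2 \in A by move=> hi; have := AD false i.+1 hi; rewrite mul1g.
have As i : i < N -> f 0 * f i.+2 \in A by exact: (AD true i.+1).
have Alit p : p.1 < N -> glit f p \in A by rewrite /glit; case: ifP => _; [apply: Af | apply: As].
have fA : <<f 1%N |: A>> = [set: gT].
  apply/eqP; rewrite eqEsubset subsetT -fG genS //.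
  apply/subsetP => _ /imsetP[[[|[|i]] hi] _ ->]; rewrite !inE ?eqxx //.
    by have := AD false 0 isT; rewrite mul1g => ->; rewrite orbT.
  by rewrite Af ?orbT.
(* A relator all of whose entries are reflections would make a power [x0 ^+ (2 ^ k)] trivial. *)
have contra l ls : all [in A] (l :: ls) -> all [predC R] (l :: ls) ->
    foldl commg (f 1%N) (l :: ls) = 1 -> False.
  move=> /= /andP[lA _] /andP[lR lsR] hc.
  have := torsion_of_commutator cosetR involR invertR abelR A2 _ lR lsR hc fA x0R.
  move=> /(_ (fun g gA _ => AA l g lA gA)) /eqP.
  by rewrite (negbTE (x0n _)).
(* If s were a rotation, a reflection y_i would make s y_i a reflection too, against the relator
   [a, y_i, s y_i]. So all of [A] would consist of rotations. *)
have sR : f 0 \notin R.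
  apply/negP => sR; have fR' i : i < N -> f i.+2 \in R.
    move=> hi; apply/negPn/negP => fiR.
    apply: (contra (f i.+2) [:: f 0 * f i.+2]) => /=.
    - by rewrite Af ?As.
    - by rewrite fiR groupMl // fiR.
    - by case: (fv i hi).
  have AR : A \subset R.
    apply/subsetP => _ /imsetP[p _ ->]; rewrite groupM ?groupX //.
    by case: p => b [[|i] hi] //=; apply: fR'.
  have [f1R|f1R] := boolP (f 1%N \in R).
    suff : [set: gT] \subset R by move/subsetP/(_ y0); rewrite inE (negbTE y0R) => /(_ isT).
    by rewrite -fA gen_subG subUset sub1set f1R.
  (* Now the image of [a] is the only generator that is a reflection. The torsion lemma is applied
     with it as [l] and with 1 in the place of [a]: the commutator is trivial for free, and [x0]
     would have order at most 2. *)
  have B2 : {in f 1%N |: A, forall g, g * g = 1}.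
    by move=> g /setU1P[->|/A2//]; apply: involR.
  have BC : {in f 1%N |: A, forall g, g \notin R -> commute (f 1%N) g}.
    by move=> g /setU1P[->//|/(subsetP AR)->].
  have := torsion_of_commutator cosetR involR invertR abelR B2 BC f1R (a := 1) (ls := [::]) isT.
  move=> /(_ x0 (comm1g _) _ x0R) h; have := x0n 1%N; rewrite h ?eqxx //.
  by apply/eqP; rewrite eqEsubset subsetT -fA genS // subsetUr.
exists (fun i => f i.+2 \notin R); apply/allP => cl hcl.
have /andP[ne /allP hN] := allP hcls cl hcl.
rewrite -[has _ _]negbK; apply/negP => /hasPn h.
(* In a violated clause every literal is a reflection: either y_i itself, or s y_i with y_i a
   rotation. *)
have litR : {in cl, forall p, glit f p \notin R}.
  move=> p /h /negPn/eqP; rewrite /glit => <-; case: ifP => // /negbFE fR'.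
  by rewrite groupMr.
have := fR (wclause cl); rewrite mem_cat map_f ?orbT // weval_clause => /(_ isT).
case: cl ne hN litR {hcl h} => // p cl _ hN litR.
apply: contra; apply/allP => _ /(mapP (s := p :: cl))[q hq ->].
  exact/Alit/hN.
exact: litR.
Qed.

End Clauses.

(** * The dihedral group of order 2n *)

Section Dihedral.
Variable n : nat.
Hypothesis n_gt1 : 1 < n.
Hypothesis n_not2 : forall k, ~~ (n %| 2 ^ k).
Local Notation gT := (gsort 'D_(n.*2)).
Local Open Scope group_scope.

(** The defining relations only bound the orders of x and y by n and 2. Since the group has 2n
    elements and is the product of the two cyclic groups, x has order exactly n and y is not a power
    of x. *)
Lemma dihedral_generators : exists x y : gT,
  [/\ #[x] = n, y ^+ 2 = 1, x ^ y = x^-1, y \notin <[x]>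
   & <[x]> * <[y]> = [set: gT] /\ <<[set x; y]>> = [set: gT]].
Proof.
have := homg_refl [set: gT]; rewrite Grp_dihedral // => /existsP[[x y] /=].
move=> /eqP[eG xn y2 xy].
have card2n : #|[set: gT]| = (2 * n)%N by rewrite card_dihedral // mul2n.
have nR : <[y]> \subset 'N(<[x]>) by rewrite norms_cycle xy groupV cycle_id.
have eG' : <[x]> * <[y]> = [set: gT] by rewrite -eG norm_joinEr.
have ox : #[x] <= n by apply: dvdn_leq (ltnW n_gt1) _; rewrite order_dvdn xn.
have oy : #[y] <= 2 by apply: dvdn_leq => //; rewrite order_dvdn y2.
have cG : (#|[set: gT]| <= #[x] * #[y])%N by rewrite -eG' [leqRHS]mul_cardG leq_pmulr ?cardG_gt0.
exists x, y; split=> //.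
- by apply/eqP; rewrite eqn_leq ox; rewrite card2n in cG; nia.
- apply/negP => yx; have : (#|[set: gT]| <= #[x])%N.
    by rewrite -eG' mulGSid // cycle_subG.
  by rewrite card2n; lia.
- by split=> //; rewrite -eG joing_idl joing_idr.
Qed.

Lemma dihedral_epi_solution N (cls : seq (seq (nat * bool))) :
  all (fun cl => (cl != [::]) && all (fun p => p.1 < N)%N cl) cls ->
  word_epi [set: gT] N.+2 (base_rels N ++ map wclause cls) <->
  exists val : nat -> bool, all (has (fun p => val p.1 != p.2)) cls.
Proof.
have [x [y [ox y2 xy yR [eG' eG]]]] := dihedral_generators.
set R := <[x]>%G.
have abelR : abelian R by apply: cycle_abelian.
have invY u : u \in R -> u ^ y = u^-1.
  by move=> /cycleP[k ->]; rewrite conjXg xy expgVn.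
have GE g : g \notin R -> exists2 u, u \in R & g = u * y.
  have : g \in <[x]> * <[y]> by rewrite eG' inE.
  case/mulsgP => u v hu /cycleP[k ->] ->.
  rewrite -[k]odd_double_half expgD -(mul2n k./2) expgM y2 expg1n mulg1.
  case: (odd k); last by rewrite mulg1 /= hu.
  by rewrite expg1; exists u.
have invert u g : u \in R -> g \notin R -> u ^ g = u^-1.
  move=> hu /GE[v hv ->]; rewrite conjgM (conjgE u v) (centsP abelR u hu v hv) mulKg.
  exact: invY.
have yy : y * y = 1 by rewrite -y2 (expgS y 1) expg1.
have invol g : g \notin R -> g * g = 1.
  move=> /GE[u hu ->]; have := invY u hu; rewrite conjgE (_ : y^-1 = y) => [e|].
    by rewrite -mulgA e mulgV.
  by apply/eqP; rewrite eq_invg_mul yy.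
have coset g h : g \notin R -> h \notin R -> g * h \in R.
  move=> /GE[u hu ->] /GE[v hv ->]; rewrite (_ : _ * _ = u * (y * v * y)); last by rewrite !mulgA.
  have -> : y * v * y = v ^ y.
    by rewrite conjgE (_ : y^-1 = y) ?mulgA //; apply/eqP; rewrite eq_invg_mul yy.
  by rewrite invY // groupM ?groupV.
have xk k : x ^+ (2 ^ k) != 1 by rewrite -order_dvdn ox.
move=> hcls; split.
  exact: (epi_solution coset invol invert abelR (cycle_id x) yR xk hcls).
by case=> val; apply: (solution_epi invol yR eG).
Qed.

End Dihedral.

(** * Local constraints as sets of clauses *)

Section Clauses.
Variables (C : finType) (c0 : C).
Local Notation B := #|C|.

(* Cell [q] of the tableau owns the variables [q * B + j]; its content is the
   first [c] whose variable is true, and [c0] if there is none. *)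
Definition decode (b : C -> bool) : C := odflt c0 [pick c | b c].

Definition cell_var (q : nat) (c : C) : nat := q * B + enum_rank c.

Definition cell_value (val : nat -> bool) q : C := decode (fun c => val (cell_var q c)).

Definition constraint := ((seq C -> bool) * seq nat)%type.

Definition holds (h : nat -> C) (k : constraint) : bool := k.1 (map h k.2).

Definition decode_pattern r (F : {ffun 'I_r * C -> bool}) : seq C :=
  [seq decode (fun c => F (i, c)) | i <- enum 'I_r].

Definition bad_patterns r (Rl : seq C -> bool) : seq {ffun 'I_r * C -> bool} :=
  [seq F <- enum {: {ffun 'I_r * C -> bool}} | ~~ Rl (decode_pattern F)].

(** An entry is satisfied when the value differs from the recorded bit, so this clause forbids the
    single pattern [F] on the cells [qs]. *)
Definition pattern_clause r (qs : seq nat) (F : {ffun 'I_r * C -> bool}) :=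
  [seq (cell_var (nth 0 qs p.1) p.2, F p) | p : 'I_r * C <- enum {: 'I_r * C}].

Definition clauses_of (k : constraint) : seq (seq (nat * bool)) :=
  map (pattern_clause k.2) (bad_patterns (size k.2) k.1).

Lemma eq_decode b b' : b =1 b' -> decode b = decode b'.
Proof. by move=> e; rewrite /decode (eq_pick e). Qed.

Lemma clauses_ofP val k :
  all (has (fun p => val p.1 != p.2)) (clauses_of k) = holds (cell_value val) k.
Proof.
case: k => Rl qs; rewrite /clauses_of /holds /=.
(* The pattern realised by [val]. It is the only one whose clause [val] can violate, and its clause
   is present exactly when the constraint fails. *)
pose F0 : {ffun 'I_(size qs) * C -> bool} :=
  [ffun p : 'I_(size qs) * C => val (cell_var (nth 0 qs p.1) p.2)].
have e0 : decode_pattern F0 = map (cell_value val) qs.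
  apply: (@eq_from_nth _ c0); rewrite !size_map -?enumT ?size_enum_ord // => i hi.
  rewrite (nth_map (Ordinal hi)) ?size_enum_ord // (nth_map 0) //.
  by apply: eq_decode => c; rewrite ffunE /= nth_enum_ord.
rewrite -e0; apply/idP/idP => [/allP h|h].
- apply: contraT => hn; have := h (pattern_clause qs F0).
  have -> : pattern_clause qs F0 \in map (pattern_clause qs) (bad_patterns (size qs) Rl).
    by apply: map_f; rewrite mem_filter hn mem_enum.
  move=> /(_ isT)/hasP[_ /mapP[p _ ->]] /=.
  by rewrite ffunE eqxx.
- apply/allP => _ /mapP[F + ->]; rewrite mem_filter => /andP[hn _].
  apply: contraNT hn; rewrite -all_predC => /allP ha.
  rewrite (_ : F = F0) //; apply/ffunP => p; rewrite ffunE; apply/esym/eqP.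
  have := ha (cell_var (nth 0 qs p.1) p.2, F p); rewrite /= negbK; apply.
  by apply: map_f; rewrite mem_enum.
Qed.

Lemma clauses_of_bound M k : all (fun q => q < M) k.2 -> k.2 != [::] ->
  all (fun cl => (cl != [::]) && all (fun p => p.1 < M * B) cl) (clauses_of k).
Proof.
case: k => Rl qs /= hq ne; apply/allP => _ /mapP[F _ ->]; apply/andP; split.
  rewrite -size_eq0 size_map -cardE card_prod card_ord muln_eq0 size_eq0 (negbTE ne) /=.
  by rewrite -lt0n; apply/card_gt0P; exists c0.
apply/allP => _ /mapP[p _ ->] /=; rewrite /cell_var.
have hq1 : nth 0 qs p.1 < M by apply: (allP hq); apply: mem_nth.
apply: leq_trans (_ : (nth 0 qs p.1).+1 * B <= _); last by rewrite leq_mul2r hq1 orbT.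
by rewrite mulSn addnC ltn_add2r.
Qed.

(** One-hot encoding: of the [B] variables of a cell, only that of its content is true. *)
Definition encode (h : nat -> C) (i : nat) : bool := enum_rank (h (i %/ B)) == i %% B :> nat.

Lemma cell_value_encode h q : cell_value (encode h) q = h q.
Proof.
have B0 : 0 < B by apply/card_gt0P; exists c0.
rewrite /cell_value /decode.
have E c : encode h (cell_var q c) = (c == h q).
  rewrite /encode /cell_var divnMDl // modnMDl divn_small ?ltn_ord // addn0 modn_small ?ltn_ord //.
  by rewrite -(inj_eq enum_rank_inj) eq_sym.
by case: pickP => [c|/(_ (h q))]; rewrite E ?eqxx // => /eqP.
Qed.

Lemma satisfiable_clauses ks :
  (exists val, all (has (fun p => val p.1 != p.2)) (flatten (map clauses_of ks))) <->
  exists h, all (holds h) ks.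
Proof.
have E val : all (has (fun p => val p.1 != p.2)) (flatten (map clauses_of ks)) =
    all (holds (cell_value val)) ks.
  by elim: ks => //= k ks IH; rewrite all_cat clauses_ofP IH.
split=> [] [v]; first by rewrite E; exists (cell_value v).
move=> hv; exists (encode v); rewrite E (@eq_all _ _ (holds v)) // => k.
by rewrite /holds (eq_map (cell_value_encode v)).
Qed.

End Clauses.

(** * The tableau of a verifier *)

Section Tableau.
Variable V : TM.
Local Notation state := (tm_state V).
Local Notation sym := (tm_sym V).
Local Notation blank := (tm_blank V).

Definition tcell : finType := (sym * option state)%type.
Definition empty_cell : tcell := (blank, None).

(** A halted head stays where it is, so rows stop changing after halting and acceptance can be read
    in the last row. *)
Definition arrival (right : bool) (c : tcell) : option state :=
  if c.2 is Some q then
    if tm_halt V q then None else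
    let: (q', _, m) := tm_delta V q c.1 in
    match m, right with MoveR, true | MoveL, false => Some q' | _, _ => None end
  else None.

Definition next_cell (l c r : tcell) : tcell :=
  if c.2 is Some q then
    if tm_halt V q then c else
    let: (q', a', m) := tm_delta V q c.1 in (a', if m is Stay then Some q' else None)
  else (c.1, if arrival true l is Some q then Some q else arrival false r).

Definition aconfig := (state * nat * (nat -> sym))%type.

Definition astep (s : aconfig) : aconfig :=
  let: (q, pos, tp) := s in
  if tm_halt V q then s else
  let: (q', a', m) := tm_delta V q (tp pos) in (q', moved m pos, upd tp pos a').

Definition row (s : aconfig) (p : nat) : tcell :=
  (s.2 p, if p == s.1.2 then Some s.1.1 else None).

(** The head moves by at most one cell, so three neighbours determine the next content of the middle
    one. Column 0 has no left neighbour and is not covered. *)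
Lemma next_cell_row s p :
  next_cell (row s p) (row s p.+1) (row s p.+2) = row (astep s) p.+1.
Proof.
case: s => [[q pos] tp]; rewrite /next_cell /row /arrival /=.
case hq: (tm_halt V q).
  by case: (p.+1 =P pos) => [_|_] /=; rewrite ?hq //; do 2?case: eqP => ? /=; rewrite ?hq.
have [e|ne] := eqVneq p.+1 pos.
  rewrite /= hq -e; case: (tm_delta V q (tp p.+1)) => [[q' a'] m] /=.
  rewrite upd_same; congr pair; case: m => //=.
    by case: eqP => //; lia.
    by case: eqP => //; lia.
  by rewrite eqxx.
have [e1|ne1] := eqVneq p pos.
  have /negbTE -> : p.+2 != pos by lia.
  rewrite /= hq -e1; case: (tm_delta V q (tp p)) => [[q' a'] m] /=.
  rewrite upd_other; last lia.
  congr pair; case: m => /=; rewrite ?eqxx //; case: eqP => //; lia.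
have [e2|ne2] := eqVneq p.+2 pos.
  rewrite /= hq -e2; case: (tm_delta V q (tp p.+2)) => [[q' a'] m] /=.
  rewrite upd_other; last lia.
  congr pair; case: m => /=; rewrite ?eqxx //; case: eqP => //; lia.
case: (tm_delta V q (tp pos)) => [[q' a'] m] /=.
rewrite upd_other //; congr pair; case: m => /=; case: eqP => //; lia.
Qed.

Lemma astep_pos s : (astep s).1.2 <= s.1.2.+1 /\ s.1.2 <= (astep s).1.2.+1.
Proof.
case: s => [[q pos] tp] /=; case: ifP => _ /=; first by lia.
by case: tm_delta => [[q' a'] [] /=]; lia.
Qed.

Lemma astep_far s p : p != s.1.2 -> (astep s).2 p = s.2 p.
Proof.
case: s => [[q pos] tp] /= ne; case: ifP => _ //=.
by case: tm_delta => [[q' a'] m] /=; rewrite upd_other.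
Qed.

Lemma represents_astep c s : represents c s.1.1 s.1.2 s.2 -> 0 < s.1.2 ->
  represents (step c) (astep s).1.1 (astep s).1.2 (astep s).2.
Proof.
case: s => [[q pos] tp] /= hc hp; case: ifPn => hq /=.
  by rewrite step_halted // (represents_state hc).
by case hd: tm_delta => [[q' a'] m]; apply: represents_step hc hq hd _.
Qed.

Section Input.
Variables (x : seq bool) (T : nat).
Local Notation n := (size x).
Local Notation start := (tm_start V).
Local Notation inp := (tm_in V).

(** The head moves left at most once per step, so starting here it is still at a positive position
    after [T] steps. The row then has room for the doubled input, two separator cells, a certificate
    of length at most [T], and two blank cells. *)
Definition origin := T + 1.
Definition width := origin + n.*2 + T + 4.
Definition inner := width - 2.

Definition init_tape (w : seq bool) (i : nat) : sym :=
  if i < origin then blank else nth blank (map inp (pair_enc x w)) (i - origin).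
Definition init_aconfig w : aconfig := (start, origin, init_tape w).
Definition aconfig_at w t := iter t astep (init_aconfig w).

Lemma aconfig_at_pos w t :
  (aconfig_at w t).1.2 <= origin + t /\ origin <= (aconfig_at w t).1.2 + t.
Proof.
elim: t => [|t [IH1 IH2]] /=; first by rewrite addn0.
have [h1 h2] := astep_pos (aconfig_at w t).
by rewrite -/(aconfig_at w t); lia.
Qed.

Lemma represents_aconfig_at w t : t <= T.+1 ->
  represents (run V t (pair_enc x w)) (aconfig_at w t).1.1 (aconfig_at w t).1.2
    (aconfig_at w t).2.
Proof.
elim: t => [_|t IH ht].
  rewrite /run /= /init_tape; case: (pair_enc x w) => [|b y]; split=> //=.
  - by rewrite ltnn subnn.
  - by move=> i; rewrite !nth_nil; case: ifP.
  - by move=> i; rewrite !nth_nil; do 2?case: ifP.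
  - by rewrite ltnn subnn.
  - move=> i; rewrite ifF; last by lia.
    by rewrite addKn.
  - by move=> i; rewrite nth_nil; case: ifP => // h; rewrite ifT //; lia.
have := represents_astep (IH (ltnW ht)); apply.
by have := (aconfig_at_pos w t).2; rewrite /origin; lia.
Qed.

Lemma accepts_aconfig w : accepts_within V (pair_enc x w) T =
  tm_halt V (aconfig_at w T).1.1 && tm_acc V (aconfig_at w T).1.1.
Proof.
by rewrite /accepts_within /halts_within (represents_state (represents_aconfig_at w (leqnSn T))).
Qed.

End Input.
End Tableau.

Lemma all_iotaP (P : pred nat) k : reflect (forall i, i < k -> P i) (all P (iota 0 k)).
Proof.
apply: (iffP allP) => h i hi; first by apply: h; rewrite mem_iota.
by apply: h; rewrite mem_iota in hi.
Qed.

Lemma all_flatten_map A B (P : pred B) (F : A -> seq B) s :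
  all P (flatten (map F s)) = all (fun a => all P (F a)) s.
Proof. by elim: s => //= a s IH; rewrite all_cat IH. Qed.

Lemma nth_pair_enc (A : Type) (d : A) (f : bool -> A) x w :
  [/\ forall i, i < size x -> nth d (map f (pair_enc x w)) i.*2 = f (nth false x i),
      forall i, i < size x -> nth d (map f (pair_enc x w)) i.*2.+1 = f (nth false x i),
      nth d (map f (pair_enc x w)) (size x).*2 = f false,
      nth d (map f (pair_enc x w)) (size x).*2.+1 = f true
    & forall i, nth d (map f (pair_enc x w)) ((size x).*2 + 2 + i) = nth d (map f w) i].
Proof.
elim: x => [|b x [h1 h2 h3 h4 h5]] //.
have e : pair_enc (b :: x) w = [:: b, b & pair_enc x w] by [].
split; rewrite ?e //=.
- by case=> [|i] //= hi; apply: h1.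
- by case=> [|i] //= hi; apply: h2.
Qed.

(** * The constraints of the tableau *)

Section Constraints.
Variable V : TM.
Local Notation blank := (tm_blank V).
Local Notation inp := (tm_in V).
Local Notation tcell := (tcell V).
Local Notation e0 := (empty_cell V).
Local Notation constraint := (constraint tcell).

Definition rel1 (R : tcell -> bool) (s : seq tcell) := R (nth e0 s 0).
Definition rel2 (R : tcell -> tcell -> bool) (s : seq tcell) := R (nth e0 s 0) (nth e0 s 1).

Definition rel_empty := rel1 (pred1 e0).
Definition rel_start := rel1 (fun c => c.2 == Some (tm_start V)).
Definition rel_no_head := rel1 (fun c => c.2 == None).
Definition rel_blank := rel1 (fun c => c.1 == blank).
Definition rel_input b1 b2 := rel2 (fun c d => (c.1 == inp b1) && (d.1 == inp b2)).
Definition is_bit (a : tm_sym V) := (a == inp false) || (a == inp true).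
(** A non-bit must be blank and followed by a blank, so the certificate zone holds a word followed
    only by blanks. *)
Definition rel_guess := rel2 (fun c d => is_bit c.1 || (c.1 == blank) && (d.1 == blank)).
(** It holds for cells without head, so it can be imposed on the whole last row although the column
    of the head is unknown. *)
Definition rel_accept := rel1 (fun c => if c.2 is Some q then tm_halt V q && tm_acc V q else true).
Definition rel_next (s : seq tcell) :=
  nth e0 s 3 == next_cell (nth e0 s 0) (nth e0 s 1) (nth e0 s 2).

Variables (x : seq bool) (T : nat).
Local Notation n := (size x).
Local Notation O := (origin T).
Local Notation S := (width x T).

Definition left_constraints : seq constraint :=
  [seq (rel_empty, [:: p]) | p <- iota 0 O] ++ [:: (rel_start, [:: O])].
Definition right_constraints : seq constraint :=
  [seq (rel_no_head, [:: O + 1 + p]) | p <- iota 0 (n.*2 + T + 3)].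
Definition input_constraints : seq constraint :=
  [seq (rel_input (nth false x i) (nth false x i), [:: O + i.*2; O + i.*2 + 1])
     | i <- iota 0 n] ++
  [:: (rel_input false true, [:: O + n.*2; O + n.*2 + 1])].
Definition guess_constraints : seq constraint :=
  [seq (rel_guess, [:: O + n.*2 + 2 + i; O + n.*2 + 2 + i + 1]) | i <- iota 0 T] ++
  [:: (rel_blank, [:: O + n.*2 + 2 + T]); (rel_blank, [:: O + n.*2 + 2 + T + 1])].
(** The two outermost columns lack a neighbour, so the step relation cannot determine them. Within
    [T] steps the head reaches neither, and both stay blank. *)
Definition border_constraints : seq constraint :=
  flatten [seq [:: (rel_empty, [:: t * S]); (rel_empty, [:: t * S + (O + n.*2 + T + 3)])]
             | t <- iota 0 (T + 1)].
Definition step_constraints : seq constraint :=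
  flatten [seq [seq (rel_next, [:: t * S + p; t * S + p + 1; t * S + p + 2;
                                   t * S + S + p + 1])
                  | p <- iota 0 (O + n.*2 + T + 2)] | t <- iota 0 T].
Definition accept_constraints : seq constraint :=
  [seq (rel_accept, [:: T * S + p]) | p <- iota 0 S].

Definition tableau : seq constraint :=
  left_constraints ++ right_constraints ++ input_constraints ++ guess_constraints ++
  border_constraints ++ step_constraints ++ accept_constraints.

Record tableau_spec (h : nat -> tcell) : Prop := TableauSpec {
  ts_left : forall p, p < O -> h p = e0;
  ts_start : (h O).2 = Some (tm_start V);
  ts_right : forall p, p < n.*2 + T + 3 -> (h (O + 1 + p)).2 = None;
  ts_input : forall i, i < n -> (h (O + i.*2)).1 = inp (nth false x i) /\
                                (h (O + i.*2 + 1)).1 = inp (nth false x i);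
  ts_sep : (h (O + n.*2)).1 = inp false /\ (h (O + n.*2 + 1)).1 = inp true;
  ts_guess : forall i, i < T -> is_bit (h (O + n.*2 + 2 + i)).1 \/
     (h (O + n.*2 + 2 + i)).1 = blank /\ (h (O + n.*2 + 2 + i + 1)).1 = blank;
  ts_blank : (h (O + n.*2 + 2 + T)).1 = blank /\ (h (O + n.*2 + 2 + T + 1)).1 = blank;
  ts_border : forall t, t < T + 1 ->
     h (t * S) = e0 /\ h (t * S + (O + n.*2 + T + 3)) = e0;
  ts_step : forall t p, t < T -> p < O + n.*2 + T + 2 ->
     h (t * S + S + p + 1) = next_cell (h (t * S + p)) (h (t * S + p + 1)) (h (t * S + p + 2));
  ts_accept : forall p q, p < S -> (h (T * S + p)).2 = Some q -> tm_halt V q && tm_acc V q }.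

Lemma tableauP h : all (holds h) tableau <-> tableau_spec h.
Proof.
rewrite /tableau !all_cat !all_flatten_map !all_map !all_seq1; split.
- case/and5P=> /andP[/all_iotaP h1 /eqP h2] /all_iotaP h3 /andP[/all_iotaP h4 /andP[/eqP h5 /eqP h5']].
  move=> /andP[/all_iotaP h6 /and3P[/eqP h7 /eqP h7' _]].
  move=> /andP[/all_iotaP h8 /andP[/all_iotaP h9 /all_iotaP h10]].
  split=> //.
  + by move=> p /h1/eqP.
  + by move=> p /h3/eqP.
  + by move=> i /h4/andP[/eqP ? /eqP ?].
  + by move=> i /h6/orP[?|/andP[/eqP ? /eqP ?]]; [left | right].
  + by move=> t /h8/and3P[/eqP ? /eqP ? _].
  + move=> t p ht hp; have := h9 t ht; rewrite all_map => /all_iotaP/(_ p hp)/eqP.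
    exact.
  + by move=> p q hp hq; have := h10 p hp; rewrite /= /holds /= /rel_accept /rel1 /= hq.
- case=> h1 h2 h3 h4 [h5 h5'] h6 [h7 h7'] h8 h9 h10; apply/and5P; split.
  + by apply/andP; split; [apply/all_iotaP => p /h1/eqP | apply/eqP].
  + by apply/all_iotaP => p /h3/eqP.
  + apply/andP; split; last by apply/andP; split; apply/eqP.
    by apply/all_iotaP => i /h4[? ?]; apply/andP; split; apply/eqP.
  + apply/andP; split; last by apply/and3P; split=> //; apply/eqP.
    apply/all_iotaP => i /h6[?|[? ?]]; apply/orP; [by left | right].
    by apply/andP; split; apply/eqP.
  + apply/and3P; split.
    * by apply/all_iotaP => t /h8[? ?]; apply/and3P; split=> //; apply/eqP.
    * apply/all_iotaP => t ht; rewrite all_map; apply/all_iotaP => p hp.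
      by apply/eqP; apply: h9.
    * apply/all_iotaP => p hp; have := h10 p.
      rewrite /= /holds /= /rel_accept /rel1 /=; case: (h _).2 => // q /(_ q hp erefl).
      exact.
Qed.

Lemma tableau_slots : all (fun k => (k.2 != [::]) && all (fun q => q < T.+1 * S) k.2) tableau.
Proof.
rewrite /tableau !all_cat !all_flatten_map !all_map !all_seq1.
have Sle : S <= T.+1 * S by rewrite mulSn leq_addr.
have tS t : t < T.+1 -> t * S + S <= T.+1 * S.
  by move=> ht; rewrite addnC -mulSn leq_mul2r ht orbT.
have SE : S = O + n.*2 + T + 4 by [].
have SO : O = T + 1 by [].
repeat (apply/andP; split) => //; try (apply/all_iotaP => i hi /=); try lia.
- by have := tS i; rewrite addn1 in hi => /(_ hi); rewrite !andbT; lia.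
- rewrite all_map; apply/all_iotaP => p hp /=.
  by have := tS i.+1 hi; rewrite mulSn; lia.
Qed.

Section Runs.
Variable w : seq bool.
Local Notation at_ t := (aconfig_at V x T w t).

Lemma init_tapeE : [/\ forall p, p < O -> init_tape V x T w p = blank,
  forall i, i < n -> init_tape V x T w (O + i.*2) = inp (nth false x i) /\
                     init_tape V x T w (O + i.*2 + 1) = inp (nth false x i),
  init_tape V x T w (O + n.*2) = inp false, init_tape V x T w (O + n.*2 + 1) = inp true
  & forall i, init_tape V x T w (O + n.*2 + 2 + i) = nth blank (map inp w) i].
Proof.
have [h1 h2 h3 h4 h5] := nth_pair_enc blank inp x w.
have E i : init_tape V x T w (O + i) = nth blank (map inp (pair_enc x w)) i.
  by rewrite /init_tape ifF ?addKn //; lia.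
split=> [p hp|i hi|||i]; rewrite -?(addnA O) ?E.
- by rewrite /init_tape hp.
- by rewrite addn1 (h1 i hi) (h2 i hi).
- exact: h3.
- by rewrite addn1.
- exact: h5.
Qed.

Lemma aconfig_at_far t p : t <= T.+1 -> p = 0 \/ O + t <= p ->
  (at_ t).2 p = init_tape V x T w p.
Proof.
elim: t => // t IH ht hp /=; rewrite -/(at_ t) astep_far; first by apply: IH; lia.
have [l1 l2] := aconfig_at_pos V x T w t; apply/eqP => ep.
by rewrite /origin in l1 l2 hp; rewrite -ep in l1 l2; lia.
Qed.

Lemma row_border t : t < T + 1 -> size w <= T ->
  row (at_ t) 0 = e0 /\ row (at_ t) (O + n.*2 + T + 3) = e0.
Proof.
move=> ht hw; have [h1 _ _ _ h5] := init_tapeE.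
have [p1 p2] := aconfig_at_pos V x T w t.
have SO : O = T + 1 by [].
have hO : 0 < O by lia.
rewrite /row !aconfig_at_far; try lia.
rewrite (h1 0 hO) (_ : O + n.*2 + T + 3 = O + n.*2 + 2 + T.+1); last by lia.
rewrite h5 nth_default ?size_map; last by lia.
split; congr pair; rewrite ifF //.
  by apply/eqP => e; rewrite -e in p2; lia.
by apply/eqP => e; rewrite -e in p1; lia.
Qed.

End Runs.

Theorem tableau_correct :
  (exists h, all (holds h) tableau) <->
  (exists w, size w <= T /\ accepts_within V (pair_enc x w) T).
Proof.
have S0 : 0 < S by rewrite /width; lia.
have SE : S = O + n.*2 + T + 4 by [].
split=> [[h /tableauP hs]|[w [hw]]]; last first.
  rewrite (accepts_aconfig _ _ _ w) => hacc.
  pose h q := row (aconfig_at V x T w (q %/ S)) (q %% S).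
  have hE t p : p < S -> h (t * S + p) = row (aconfig_at V x T w t) p.
    by move=> hp; rewrite /h divnMDl // modnMDl divn_small // addn0 modn_small.
  have h0 p : p < S -> h p = row (init_aconfig V x T w) p by move=> hp; rewrite -(hE 0).
  have [i1 i2 i3 i4 i5] := init_tapeE w.
  exists h; apply/tableauP; split.
  - move=> p hp; rewrite h0 ?/row /= ?i1 ?ifF //; lia.
  - by rewrite h0 ?/row /= ?eqxx //; lia.
  - by move=> p hp; rewrite h0 ?/row /= ?ifF //; lia.
  - by move=> i hi; rewrite !h0 ?/row /=; try lia; apply: i2.
  - by rewrite !h0 ?/row /=; try lia.
  - move=> i hi; rewrite !h0 ?/row /=; try lia.
    rewrite -(addnA _ i 1) !i5; case: (ltnP i (size w)) => hiw.
      by left; rewrite (nth_map false) // /is_bit; case: (nth _ _ _); rewrite eqxx ?orbT.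
    by right; rewrite !nth_default ?size_map //; lia.
  - rewrite !h0 ?/row /=; try lia.
    by rewrite -(addnA _ T 1) !i5 !nth_default ?size_map //; lia.
  - move=> t ht; rewrite -[t * S]addn0 hE // addn0 hE; last lia.
    exact: row_border.
  - move=> t p ht hp; rewrite (_ : t * S + S + p + 1 = t.+1 * S + p.+1); last lia.
    rewrite -[t * S + p + 1]addnA -[t * S + p + 2]addnA !hE; try lia.
    by rewrite addn1 addn2 next_cell_row.
  - by move=> p q hp; rewrite hE // /row /=; case: eqP => // _ [<-].
case: hs => h1 h2 h3 h4 [h5 h5'] h6 [h7 h7'] h8 h9 h10.
pose c i := (h (O + n.*2 + 2 + i)).1.
have cS i : c i.+1 = (h (O + n.*2 + 2 + i + 1)).1 by congr (h _).1; lia.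
pose m := find (fun i => ~~ is_bit (c i)) (iota 0 T).
(* The certificate is read up to the first non-bit. Only its image under [inp] matters, so it is
   harmless if the two bits share a symbol. *)
pose w := [seq c i != inp false | i <- iota 0 m].
have mT : m <= T by rewrite -[T in _ <= T](size_iota 0) find_size.
have size_w : size w = m by rewrite size_map size_iota.
have bits i : i < m -> nth blank (map inp w) i = c i.
  move=> hi; rewrite (nth_map false) ?size_w // (nth_map 0) ?size_iota // nth_iota // add0n.
  have := before_find 0 hi; rewrite nth_iota ?(leq_trans hi) // add0n => /negbFE.
  by rewrite /is_bit; case: eqP => //= _ /eqP.
(* Cell [m] is blank and not a bit; hence each further guess constraint passes the blank on to the
   right, and the last two cells have constraints of their own. *)
have blanks i : m <= i -> i <= T.+1 -> c i = blank.
  case: (ltngtP m T) => [mlt|mgt|mT']; first last.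
  - move=> l1 l2; have [->|->] : i = T \/ i = T.+1 by lia.
      exact: h7.
    by rewrite cS.
  - lia.
  have nb : ~~ is_bit (c m).
    have /(nth_find 0) : has (fun i => ~~ is_bit (c i)) (iota 0 T).
      by rewrite has_find size_iota.
    by rewrite nth_iota.
  have cm : c m = blank by have [hb|[]//] := h6 m mlt; rewrite /c hb in nb.
  elim: i => [|i IH]; first by rewrite leqn0 => /eqP <-.
  rewrite leq_eqVlt => /orP[/eqP<-//|]; rewrite ltnS => hi hi2.
  have [iT|iT] := ltnP i T; last first.
    have -> : i = T by lia.
    by rewrite cS.
  have ci := IH hi (leq_trans (ltnW iT) (leqnSn T)).
  have [hb|[_ <-]] := h6 i iT; last by rewrite cS.
  by rewrite -/(c i) ci -cm (negbTE nb) in hb.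
exists w; rewrite size_w; split=> //.
have [i1 i2 i3 i4 i5] := init_tapeE w.
have row0 p : p < S -> h p = row (init_aconfig V x T w) p.
  move=> hp; rewrite /row /=; case: (ltngtP p O) => hpO.
  - by rewrite h1 // i1.
  - have hd : (h p).2 = None.
      by have := h3 (p - O - 1); rewrite (_ : O + 1 + _ = p); [apply; lia | lia].
    rewrite [LHS]surjective_pairing hd; congr pair.
    have [lt1|ge1] := ltnP (p - O) n.*2.
      have := i2 (p - O)./2; have := h4 (p - O)./2.
      have [e|e] : p = O + (p - O)./2.*2 \/ p = O + (p - O)./2.*2 + 1 by lia.
        by rewrite -e => -[|-> _]; [lia | case=> [|-> _]; [lia|]].
      by rewrite -e => -[|_ ->]; [lia | case=> [|_ ->]; [lia|]].
    have [->|] := eqVneq p (O + n.*2); first by rewrite h5 i3.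
    have [->|] := eqVneq p (O + n.*2 + 1); first by rewrite h5' i4.
    move=> ne1 ne2; have [i e] : exists i, p = O + n.*2 + 2 + i by exists (p - (O + n.*2 + 2)); lia.
    rewrite e i5; have [im|im] := ltnP i m; first by rewrite bits.
    by rewrite nth_default ?size_map ?size_iota //; apply: (blanks i) => //; lia.
  - rewrite hpO [LHS]surjective_pairing h2; congr pair.
    have [n0|n0] := posnP n.
      by have := i3; have := h5; rewrite n0 addn0 => -> ->.
    by have [+ _] := h4 0 n0; have [+ _] := i2 0 n0; rewrite addn0 => -> ->.
(* By induction on time every row is forced: the outer columns by the border constraints, the inner
   ones by [next_cell]. *)
have rows t p : t < T.+1 -> p < S -> h (t * S + p) = row (aconfig_at V x T w t) p.
  rewrite -(addn1 T); elim: t p => [|t IH] p ht hp; first exact: row0.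
  have [hb1 hb2] := h8 t.+1 ht; have [rb1 rb2] := row_border ht (leq_trans (eq_leq size_w) mT).
  have [->|p0] := posnP p; first by rewrite addn0 hb1 rb1.
  have [->|pS] := eqVneq p (O + n.*2 + T + 3); first by rewrite hb2 rb2.
  have ht' : t < T by rewrite addn1 in ht.
  have := h9 t p.-1 ht'; rewrite (_ : t * S + S + p.-1 + 1 = t.+1 * S + p); last lia.
  move=> -> //; last lia.
  rewrite -[t * S + p.-1 + 1]addnA -[t * S + p.-1 + 2]addnA !IH; try lia.
  by rewrite addn1 addn2 next_cell_row prednK.
rewrite (accepts_aconfig _ _ _ w).
have [p1 _] := aconfig_at_pos V x T w T.
apply: (h10 (aconfig_at V x T w T).1.2); first lia.
by rewrite rows ?/row /= ?eqxx //; lia.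
Qed.

End Constraints.

(** * The program printing the presentation *)

Section LetterPredicates.
Variable A : Type.
Implicit Types (Q : pred A) (u v : seq (A * bool)).

Definition letters Q u := all (fun l => Q l.1) u.

Lemma letters_wcomm Q u v : letters Q u -> letters Q v -> letters Q (wcomm u v).
Proof.
have inv w : letters Q (winv w) = letters Q w by rewrite /letters /winv all_rev all_map.
by move=> hu hv; rewrite /wcomm /letters !all_cat -!/(letters _ _) !inv hu hv.
Qed.

Lemma letters_foldl_wcomm Q u vs :
  letters Q u -> all (letters Q) vs -> letters Q (foldl (@wcomm A) u vs).
Proof.
by elim: vs u => //= v vs IH u hu /andP[hv hvs]; apply: IH => //; apply: letters_wcomm.
Qed.

End LetterPredicates.

Lemma map_wcomm (A A' : Type) (g : A -> A') u v :
  [seq (g l.1, l.2) | l <- wcomm u v] =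
  wcomm [seq (g l.1, l.2) | l <- u] [seq (g l.1, l.2) | l <- v].
Proof.
have inv w : [seq (g l.1, l.2) | l <- winv w] = winv [seq (g l.1, l.2) | l <- w].
  by rewrite /winv map_rev -!map_comp.
by rewrite /wcomm !map_cat !inv.
Qed.

Lemma map_foldl_wcomm (A A' : Type) (g : A -> A') u vs :
  [seq (g l.1, l.2) | l <- foldl (@wcomm A) u vs] =
  foldl (@wcomm A') [seq (g l.1, l.2) | l <- u] [seq [seq (g l.1, l.2) | l <- v] | v <- vs].
Proof. by elim: vs u => //= v vs IH u; rewrite IH map_wcomm. Qed.

Section Blocks.
Variables (V : finType) (vt vu v0 : V).
Hypothesis v0_vt : v0 != vt.
Implicit Types (x : seq bool) (sg : V -> nat) (E : prog V).

Definition cats (Es : seq (prog V)) : prog V := foldr (@Cat V) (Emit V [::]) Es.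

Lemma sem_cats x Es sg : sem x (cats Es) sg = flatten [seq sem x E sg | E <- Es].
Proof. by elim: Es => //= E Es ->. Qed.

Lemma wf_cats Es : wf (cats Es) = all (@wf V) Es.
Proof. by elim: Es => //= E Es ->. Qed.

Lemma bound_cats v Es : (v \in bound (cats Es)) = has (fun E => v \in bound E) Es.
Proof. by elim: Es => //= E Es <-; rewrite mem_cat. Qed.

Inductive term := Cst of nat | Var of V | Mul of V & V.

Definition term_value sg t :=
  match t with Cst m => m | Var v => sg v | Mul u v => sg u * sg v end.
Definition term_ok t :=
  match t with
  | Cst _ => true
  | Var v => v != vt
  | Mul u v => [&& u != vt, u != vu, v != vt & v != vu]
  end.
(** To be run under [Let], where only the number of bits counts: a sum is a concatenation and a
    product is a double loop. *)
Definition count_term t : prog V :=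
  match t with
  | Cst m => Emit V (nseq m false)
  | Var v => For vt v (Emit V [:: false])
  | Mul u v => For vu u (For vt v (Emit V [:: false]))
  end.

Definition value sg ts := sumn (map (term_value sg) ts).
Definition count_prog ts := cats (map count_term ts).

Lemma size_flatten_iota (F : nat -> seq bool) k a :
  (forall i, size (F i) = a) -> size (flatten (map F (iota 0 k))) = k * a.
Proof.
move=> h; rewrite -[k in RHS](size_iota 0).
by elim: (iota 0 k) => //= i s IH; rewrite size_cat h IH mulSn.
Qed.

Lemma size_count_prog x ts sg : all term_ok ts -> size (sem x (count_prog ts) sg) = value sg ts.
Proof.
rewrite /count_prog sem_cats /value; elim: ts => //= t ts IH /andP[ht hts].
rewrite size_cat IH //; congr (_ + _); case: t ht => [m|v|u v] /=.
- by rewrite size_nseq.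
- by move=> _; rewrite (size_flatten_iota _ (a := 1)) ?muln1.
- move=> /and4P[_ _ _ h4]; apply: size_flatten_iota => i.
  by rewrite upd_other // (size_flatten_iota _ (a := 1)) ?muln1.
Qed.

Lemma unaryD a b : unary (a + b) = unary a ++ unary b.
Proof. by rewrite /unary nseqD flatten_cat. Qed.

Lemma flatten_unary k m : flatten [seq unary m | _ <- iota 0 k] = unary (k * m).
Proof.
rewrite -[k in RHS](size_iota 0); elim: (iota 0 k) => //= _ s ->.
by rewrite mulSn unaryD.
Qed.

(* (v, mu, off) stands for the letter index [sg v * mu + off]. *)
Definition sletter := (V * nat * nat)%type.
Definition svalue sg (l : sletter) := sg l.1.1 * l.1.2 + l.2.

Definition emit_letter (l : sletter * bool) : prog V :=
  Cat (For vt l.1.1.1 (Emit V (unary l.1.1.2)))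
      (Emit V (unary l.1.2 ++ (if l.2 then tokLn else tokLp))).
Definition emit_word w : prog V := Cat (cats (map emit_letter w)) (Emit V tokW).
Definition emit_words ws : prog V := cats (map emit_word ws).

Definition ev sg (w : seq (sletter * bool)) := [seq (svalue sg l.1, l.2) | l <- w].

Lemma sem_emit_words x ws sg : sem x (emit_words ws) sg = wenc_rels (map (ev sg) ws).
Proof.
rewrite /emit_words sem_cats /wenc_rels -!map_comp; congr flatten; apply: eq_map => w /=.
rewrite sem_cats /wenc_word /ev -!map_comp; congr (flatten _ ++ _); apply: eq_map => l /=.
by rewrite flatten_unary catA -unaryD.
Qed.

Lemma bound_emit_words v ws : v != vt -> (v \in bound (emit_words ws)) = false.
Proof.
move=> /negbTE h; rewrite /emit_words bound_cats has_map; apply/hasP => -[w _] /=.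
rewrite cats0 bound_cats has_map => /hasP[l _] /=.
by rewrite inE h.
Qed.

Lemma all_bound_emit_words (P : pred V) ws : P vt -> all P (bound (emit_words ws)).
Proof.
move=> h; apply/allP => v; case: (eqVneq v vt) => [->//|/(bound_emit_words ws)->].
by [].
Qed.

Definition avoids_vt (w : seq (sletter * bool)) := letters (fun l => l.1.1 != vt) w.

Lemma wf_emit_words ws : all avoids_vt ws -> wf (emit_words ws).
Proof.
rewrite /emit_words wf_cats all_map => /allP h; apply/allP => w /h hw /=.
rewrite wf_cats all_map andbT; apply/allP => l hl /=.
by rewrite eq_sym (allP hw).
Qed.

Definition bump (l : sletter) : sletter := (l.1, l.2.+2).
(** A constant index is written as zero times the dummy variable [v0] plus an offset; [bump] skips
    the indices of s and a. *)
Definition swlit (p : sletter * bool) : seq (sletter * bool) :=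
  if p.2 then [:: (bump p.1, false)] else [:: (v0, 0, 0, false); (bump p.1, false)].
Definition swclause cl : seq (sletter * bool) :=
  foldl (@wcomm sletter) [:: (v0, 0, 1, false)] (map swlit cl).

Lemma ev_swclause sg cl : ev sg (swclause cl) = wclause (ev sg cl).
Proof.
rewrite /ev /swclause map_foldl_wcomm /wclause -!map_comp; congr foldl.
  by rewrite /= /svalue /= muln0.
apply: eq_map => -[[[v mu] off] [|]] /=; rewrite /swlit /wlit /ltr /svalue /= ?muln0 ?addnS //.
Qed.

Lemma avoids_swclause cl : avoids_vt cl -> avoids_vt (swclause cl).
Proof.
move=> h; apply: letters_foldl_wcomm; first by rewrite /letters /= v0_vt.
rewrite all_map; apply: sub_all h => -[l [|]] /= hl; rewrite /letters /= ?hl //.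
by rewrite v0_vt.
Qed.

Definition svar (v : V) : sletter := (v, 1, 0).
Definition sgen (v : V) : seq (sletter * bool) := [:: (v, 1, 2, false)].
Definition srefl : seq (sletter * bool) := [:: (v0, 0, 0, false)].

Definition emit_square_rel := emit_words [:: srefl ++ srefl].
Definition emit_var_rels (v : V) := emit_words
  [:: sgen v ++ sgen v; wcomm srefl (sgen v); swclause [:: (svar v, true); (svar v, false)]].
Definition emit_pair_rel (u v : V) := emit_words [:: wcomm (sgen u) (sgen v)].

Lemma ev_srefl sg : ev sg srefl = ltr 0.
Proof. by rewrite /ev /= /svalue /= muln0. Qed.

Lemma ev_sgen sg v : ev sg (sgen v) = ltr (sg v).+2.
Proof. by rewrite /ev /= /svalue /= muln1 addn2. Qed.

Lemma ev_wcomm sg u v : ev sg (wcomm u v) = wcomm (ev sg u) (ev sg v).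
Proof. exact: map_wcomm. Qed.

Lemma sem_square_rel x sg : sem x emit_square_rel sg = wenc_rels [:: ltr 0 ++ ltr 0].
Proof. by rewrite sem_emit_words /= /svalue /= !muln0. Qed.

Lemma sem_var_rels x sg v : sem x (emit_var_rels v) sg = wenc_rels (var_rels (sg v)).
Proof.
rewrite sem_emit_words /var_rels !map_cons ev_wcomm ev_swclause ev_srefl ev_sgen.
by rewrite /ev /= /svalue /= !muln1 !addn0 !addn2.
Qed.

Lemma sem_pair_rel x sg u v : sem x (emit_pair_rel u v) sg = wenc_rels [:: pair_rel (sg u) (sg v)].
Proof. by rewrite sem_emit_words !map_cons ev_wcomm !ev_sgen. Qed.

Lemma wf_square_rel : wf emit_square_rel.
Proof. by apply: wf_emit_words; rewrite /= /avoids_vt /letters /= v0_vt. Qed.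

Lemma wf_var_rels v : v != vt -> wf (emit_var_rels v).
Proof.
move=> hv; apply: wf_emit_words; apply/and4P; split=> //.
- by rewrite /avoids_vt /letters /= hv.
- by rewrite /avoids_vt; apply: letters_wcomm; rewrite /letters /= ?v0_vt ?hv.
- by apply: avoids_swclause; rewrite /avoids_vt /letters /= hv.
Qed.

Lemma wf_pair_rel u v : u != vt -> v != vt -> wf (emit_pair_rel u v).
Proof.
move=> hu hv; apply: wf_emit_words; apply/andP; split=> //.
by rewrite /avoids_vt; apply: letters_wcomm; rewrite /letters /= ?hu ?hv.
Qed.

Section Constraints.
Variables (C : finType) (c0 : C).

(** All bad patterns are enumerated when the program is written. At run time only the numbers of the
    cells enter, each multiplied by [#|C|] to reach its block of variables. *)
Definition emit_constraint (Rl : seq C -> bool) (vs : seq V) : prog V :=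
  emit_words [seq swclause
     [seq ((nth v0 vs p.1, #|C|, nat_of_ord (enum_rank p.2)), F p)
        | p : 'I_(size vs) * C <- enum {: 'I_(size vs) * C}]
   | F : {ffun 'I_(size vs) * C -> bool} <- bad_patterns c0 (size vs) Rl].

Lemma sem_constraint x Rl vs sg : sem x (emit_constraint Rl vs) sg =
  wenc_rels (map wclause (clauses_of c0 (Rl, map sg vs))).
Proof.
rewrite sem_emit_words; congr wenc_rels; rewrite /clauses_of /=.
have E r : r = size vs ->
    map (pattern_clause (map sg vs)) (bad_patterns c0 r Rl) =
    map (pattern_clause (map sg vs)) (bad_patterns c0 (size vs) Rl) by move->.
rewrite (E _ (size_map _ _)) -!map_comp; apply: eq_map => F /=.
rewrite ev_swclause; congr wclause; rewrite /ev /pattern_clause -map_comp.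
apply: eq_map => p /=; rewrite /svalue /cell_var /= (nth_map v0) //.
Qed.

Lemma wf_constraint Rl vs : all (fun v => v != vt) vs -> wf (emit_constraint Rl vs).
Proof.
move=> h; apply: wf_emit_words; rewrite all_map; apply/allP => F _ /=.
apply: avoids_swclause; rewrite /avoids_vt /letters all_map; apply/allP => p _ /=.
by apply: (allP h); apply: mem_nth.
Qed.

Lemma bound_constraint v Rl vs : v != vt -> (v \in bound (emit_constraint Rl vs)) = false.
Proof. exact: bound_emit_words. Qed.

End Constraints.
End Blocks.

Lemma wenc_rels_cat r1 r2 : wenc_rels (r1 ++ r2) = wenc_rels r1 ++ wenc_rels r2.
Proof. by rewrite /wenc_rels map_cat flatten_cat. Qed.

Lemma wenc_rels_flatten_map A (F : A -> seq word) s :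
  wenc_rels (flatten (map F s)) = flatten [seq wenc_rels (F a) | a <- s].
Proof. by elim: s => //= a s IH; rewrite wenc_rels_cat IH. Qed.

(** * Assembling the reduction *)

Section Reduction.
Variables (M : TM) (c k : nat).
Local Notation tcell := (tcell M).
Local Notation e0 := (empty_cell M).
Local Notation B := #|tcell|.

(** Sixteen named counters, and one loop index for each of the [k] nested loops that compute the
    power in the certificate bound. *)
Definition pvar : finType := ('I_16 + 'I_k)%type.

(* Input length; certificate bound T; origin; width; numbers of cells and of
   Boolean variables; length of the part of a row right of the origin; inner width. *)
Local Notation vn := (inl (@Ordinal 16 0 isT) : pvar).
Local Notation vT := (inl (@Ordinal 16 1 isT) : pvar).
Local Notation vO := (inl (@Ordinal 16 2 isT) : pvar).
Local Notation vS := (inl (@Ordinal 16 3 isT) : pvar).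
Local Notation vC := (inl (@Ordinal 16 4 isT) : pvar).
Local Notation vN := (inl (@Ordinal 16 5 isT) : pvar).
Local Notation vR := (inl (@Ordinal 16 6 isT) : pvar).
Local Notation vP := (inl (@Ordinal 16 7 isT) : pvar).
Local Notation vi := (inl (@Ordinal 16 8 isT) : pvar).
Local Notation vj := (inl (@Ordinal 16 9 isT) : pvar).
Local Notation q1 := (inl (@Ordinal 16 10 isT) : pvar).
Local Notation q2 := (inl (@Ordinal 16 11 isT) : pvar).
Local Notation q3 := (inl (@Ordinal 16 12 isT) : pvar).
Local Notation q4 := (inl (@Ordinal 16 13 isT) : pvar).
Local Notation vt := (inl (@Ordinal 16 14 isT) : pvar).
Local Notation vu := (inl (@Ordinal 16 15 isT) : pvar).

Local Notation Emit := (Emit pvar).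
Local Notation LetE q ts E := (Let q (count_prog vt vu ts) E).
Local Notation constr := (emit_constraint vt vn e0).
Implicit Types (x : seq bool) (sg : pvar -> nat).

Lemma sem_Let x v E1 E2 sg :
  sem x (Let v E1 E2) sg = sem x E2 (upd sg v (size (sem x E1 sg))).
Proof. by []. Qed.

Lemma sem_LetE x q ts E sg : all (term_ok vt vu) ts ->
  sem x (LetE q ts E) sg = sem x E (upd sg q (value sg ts)).
Proof. by move=> h /=; rewrite size_count_prog. Qed.

Lemma sem_Cat x E1 E2 sg : sem x (Cat E1 E2) sg = sem x E1 sg ++ sem x E2 sg.
Proof. by []. Qed.

Definition power_prog (s : seq 'I_k) : prog pvar :=
  foldr (fun i E => For (inr i : pvar) vn E) (Emit (nseq c false)) s.
Definition bound_prog : prog pvar := Cat (power_prog (enum 'I_k)) (Emit (nseq c false)).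

Lemma size_bound_prog x sg : size (sem x bound_prog sg) = polyb c k (sg vn).
Proof.
have H s : size (sem x (power_prog s) sg) = c * sg vn ^ size s.
  elim: s sg => [|i s IH] sg /=; first by rewrite size_nseq muln1.
  rewrite (size_flatten_iota _ (a := c * sg vn ^ size s)) ?expnS; first by rewrite mulnCA.
  by move=> j; rewrite IH.
by rewrite /= size_cat size_nseq H size_enum_ord.
Qed.

Definition enc_ks (ks : seq (constraint tcell)) : seq bool :=
  wenc_rels (map wclause (flatten (map (clauses_of e0) ks))).

Lemma enc_ks_cat k1 k2 : enc_ks (k1 ++ k2) = enc_ks k1 ++ enc_ks k2.
Proof. by rewrite /enc_ks map_cat flatten_cat map_cat wenc_rels_cat. Qed.

Lemma enc_ks_cons k1 k2 : enc_ks (k1 :: k2) = enc_ks [:: k1] ++ enc_ks k2.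
Proof. exact: (enc_ks_cat [:: k1]). Qed.

Lemma enc_ks_map A (F : A -> constraint tcell) s :
  enc_ks (map F s) = flatten [seq enc_ks [:: F a] | a <- s].
Proof. by elim: s => //= a s IH; rewrite enc_ks_cons IH. Qed.

Lemma enc_ks_flatten_map A (F : A -> seq (constraint tcell)) s :
  enc_ks (flatten (map F s)) = flatten [seq enc_ks (F a) | a <- s].
Proof. by elim: s => //= a s IH; rewrite enc_ks_cat IH. Qed.

Lemma sem_constr x Rl vs sg : sem x (constr Rl vs) sg = enc_ks [:: (Rl, map sg vs)].
Proof. by rewrite sem_constraint /enc_ks /= cats0. Qed.

Definition left_prog := Cat (For vi vO (constr (@rel_empty M) [:: vi])) (constr (@rel_start M) [:: vO]).
Definition right_prog :=
  LetE vR [:: Var vn; Var vn; Var vT; Cst _ 3]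
    (For vi vR (LetE q1 [:: Var vO; Cst _ 1; Var vi] (constr (@rel_no_head M) [:: q1]))).
Definition input_prog := Cat
  (For vi vn (LetE q1 [:: Var vO; Var vi; Var vi] (LetE q2 [:: Var q1; Cst _ 1]
     (IfIn vi (constr (@rel_input M true true) [:: q1; q2])
              (constr (@rel_input M false false) [:: q1; q2])))))
  (LetE q1 [:: Var vO; Var vn; Var vn] (LetE q2 [:: Var q1; Cst _ 1]
     (constr (@rel_input M false true) [:: q1; q2]))).
Definition guess_prog := Cat
  (For vi vT (LetE q1 [:: Var vO; Var vn; Var vn; Cst _ 2; Var vi]
     (LetE q2 [:: Var q1; Cst _ 1] (constr (@rel_guess M) [:: q1; q2]))))
  (LetE q1 [:: Var vO; Var vn; Var vn; Cst _ 2; Var vT] (LetE q2 [:: Var q1; Cst _ 1]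
     (Cat (constr (@rel_blank M) [:: q1]) (constr (@rel_blank M) [:: q2])))).
(** The limit [vO] serves here as the number of rows: both are T + 1. *)
Definition border_prog :=
  For vi vO (LetE q1 [:: Mul vi vS]
    (LetE q2 [:: Var q1; Var vO; Var vn; Var vn; Var vT; Cst _ 3]
      (Cat (constr (@rel_empty M) [:: q1]) (constr (@rel_empty M) [:: q2])))).
Definition step_prog :=
  LetE vP [:: Var vO; Var vn; Var vn; Var vT; Cst _ 2]
    (For vi vT (For vj vP
      (LetE q1 [:: Mul vi vS; Var vj] (LetE q2 [:: Var q1; Cst _ 1]
        (LetE q3 [:: Var q1; Cst _ 2] (LetE q4 [:: Var q1; Var vS; Cst _ 1]
           (constr (@rel_next M) [:: q1; q2; q3; q4]))))))).
Definition accept_prog :=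
  For vi vS (LetE q1 [:: Mul vT vS; Var vi] (constr (@rel_accept M) [:: q1])).

Definition tableau_prog :=
  Cat left_prog (Cat right_prog (Cat input_prog (Cat guess_prog
    (Cat border_prog (Cat step_prog accept_prog))))).
Definition base_prog :=
  Cat (emit_square_rel vt vn) (Cat (For vi vN (emit_var_rels vt vn vi))
    (For vi vN (For vj vN (emit_pair_rel vt vi vj)))).
(** The header counts two generators, s and a, besides the [vN] Boolean variables. *)
Definition body_prog :=
  Cat (Cat (For vt vN (Emit tokU)) (Emit (tokU ++ tokU ++ tokW))) (Cat base_prog tableau_prog).

(** The tableau has T + 1 rows of width S, whence T S + S for [vC]; each cell owns [B] variables. *)
Definition reduction_prog :=
  Let vT bound_prog
  (LetE vO [:: Var vT; Cst _ 1]
  (LetE vS [:: Var vO; Var vn; Var vn; Var vT; Cst _ 4]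
  (LetE vC [:: Mul vT vS; Var vS]
  (Let vN (For vt vC (Emit (nseq B false))) body_prog)))).

Section Semantics.
Variables (x : seq bool) (T : nat).
Local Notation n := (size x).

Record store_ok sg : Prop := StoreOk {
  so_n : sg vn = n; so_T : sg vT = T; so_O : sg vO = origin T; so_S : sg vS = width x T }.

Lemma sem_For_eq u v E sg m (F : nat -> seq bool) : sg u = m ->
  (forall i, i < m -> sem x E (upd sg v i) = F i) ->
  sem x (For v u E) sg = flatten [seq F i | i <- iota 0 m].
Proof.
move=> <- h /=; congr flatten; apply/eq_in_map => i; rewrite mem_iota => hi.
exact: h.
Qed.

Lemma sem_left sg : store_ok sg -> sem x left_prog sg = enc_ks (left_constraints M T).
Proof.
case=> hn hT hO hS; rewrite /left_constraints enc_ks_cat enc_ks_map.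
rewrite sem_Cat; congr (_ ++ _); last by rewrite sem_constr /= hO.
apply: sem_For_eq hO _ => i _.
by rewrite sem_constr /= /upd /=.
Qed.

Lemma sem_right sg : store_ok sg -> sem x right_prog sg = enc_ks (right_constraints M x T).
Proof.
case=> hn hT hO hS; rewrite /right_prog sem_LetE // enc_ks_map.
apply: sem_For_eq => [|i _]; first by rewrite upd_same /value /= hn hT; lia.
rewrite sem_LetE // sem_constr /= /value /upd /= hO.
by congr (enc_ks [:: (_, [:: _])]); lia.
Qed.

Lemma sem_input sg : store_ok sg -> sem x input_prog sg = enc_ks (input_constraints M x T).
Proof.
case=> hn hT hO hS; rewrite /input_constraints enc_ks_cat enc_ks_map.
rewrite sem_Cat; congr (_ ++ _).
  apply: sem_For_eq => // i _; rewrite !sem_LetE //=.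
  rewrite !sem_constr /upd /value /= /value /upd /= hO.
  by case: (nth false x i) => /=; congr (enc_ks [:: (_, [:: _; _])]); lia.
rewrite !sem_LetE //= sem_constr /= /value /upd /= hO hn.
by congr (enc_ks [:: (_, [:: _; _])]); lia.
Qed.

Lemma sem_guess sg : store_ok sg -> sem x guess_prog sg = enc_ks (guess_constraints M x T).
Proof.
case=> hn hT hO hS; rewrite /guess_constraints enc_ks_cat enc_ks_map.
rewrite sem_Cat; congr (_ ++ _).
  apply: sem_For_eq => // i _; rewrite !sem_LetE //=.
  rewrite !sem_constr /= /value /upd /= hO hn.
  by congr (enc_ks [:: (_, [:: _; _])]); lia.
rewrite !sem_LetE //= !sem_constr /= /value /upd /= hO hn hT -enc_ks_cat /=.
by congr (enc_ks [:: (_, [:: _]); (_, [:: _])]); lia.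
Qed.

Lemma sem_border sg : store_ok sg -> sem x border_prog sg = enc_ks (border_constraints M x T).
Proof.
case=> hn hT hO hS; rewrite /border_constraints enc_ks_flatten_map.
apply: sem_For_eq => // i _; rewrite !sem_LetE //=.
rewrite !sem_constr /= /value /upd /= hO hn hT hS -enc_ks_cat /=.
by congr (enc_ks [:: (_, [:: _]); (_, [:: _])]); lia.
Qed.

Lemma sem_step sg : store_ok sg -> sem x step_prog sg = enc_ks (step_constraints M x T).
Proof.
case=> hn hT hO hS; rewrite /step_constraints enc_ks_flatten_map /step_prog sem_LetE //.
apply: sem_For_eq => // i _; rewrite enc_ks_map.
apply: sem_For_eq => [|j _]; first by rewrite /value /upd /= hO hn hT; lia.
rewrite !sem_LetE // sem_constr /= /value /upd /= hS.
by congr (enc_ks [:: (_, [:: _; _; _; _])]); lia.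
Qed.

Lemma sem_accept sg : store_ok sg -> sem x accept_prog sg = enc_ks (accept_constraints M x T).
Proof.
case=> hn hT hO hS; rewrite /accept_constraints enc_ks_map.
apply: sem_For_eq => // i _; rewrite !sem_LetE // sem_constr /= /value /upd /= hT hS.
by congr (enc_ks [:: (_, [:: _])]); lia.
Qed.

Lemma sem_Cat_eq E1 E2 sg s1 s2 :
  sem x E1 sg = s1 -> sem x E2 sg = s2 -> sem x (Cat E1 E2) sg = s1 ++ s2.
Proof. by move=> /= -> ->. Qed.

Lemma sem_tableau sg : store_ok sg -> sem x tableau_prog sg = enc_ks (tableau M x T).
Proof.
move=> ok; rewrite /tableau.
rewrite enc_ks_cat; apply: sem_Cat_eq (sem_left ok) _.
rewrite enc_ks_cat; apply: sem_Cat_eq (sem_right ok) _.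
rewrite enc_ks_cat; apply: sem_Cat_eq (sem_input ok) _.
rewrite enc_ks_cat; apply: sem_Cat_eq (sem_guess ok) _.
rewrite enc_ks_cat; apply: sem_Cat_eq (sem_border ok) _.
by rewrite enc_ks_cat; apply: sem_Cat_eq (sem_step ok) (sem_accept ok).
Qed.

Lemma sem_base sg N : sg vN = N -> sem x base_prog sg = wenc_rels (base_rels N).
Proof.
move=> hN; rewrite /base_rels -cat1s !wenc_rels_cat; apply: sem_Cat_eq.
  exact: sem_square_rel.
rewrite !wenc_rels_flatten_map; apply: sem_Cat_eq.
  by apply: sem_For_eq => // i _; rewrite sem_var_rels upd_same.
apply: sem_For_eq => // i _.
rewrite (_ : map _ _ = flatten [seq [:: pair_rel i j] | j <- iota 0 N]); last first.
  by elim: (iota 0 N) => //= j s ->.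
rewrite wenc_rels_flatten_map; apply: sem_For_eq => [|j _]; first by rewrite /upd.
by rewrite sem_pair_rel /upd.
Qed.

Lemma sem_body sg N : store_ok sg -> sg vN = N ->
  sem x body_prog sg =
  wenc N.+2 (base_rels N ++ map wclause (flatten (map (clauses_of e0) (tableau M x T)))).
Proof.
move=> ok hN; rewrite /wenc wenc_rels_cat catA; apply: sem_Cat_eq; last first.
  by apply: sem_Cat_eq; [apply: sem_base | apply: sem_tableau].
rewrite -[N.+2]addn2 unaryD -catA; apply: sem_Cat_eq; last by [].
by rewrite /= hN (flatten_unary N 1) muln1.
Qed.

End Semantics.

Lemma wf_power_prog s : uniq s ->
  wf (power_prog s) && (bound (power_prog s) == map inr s :> seq pvar).
Proof.
elim: s => //= i s IH /andP[hi /IH/andP[-> /eqP->]]; rewrite eqxx andbT /=.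
rewrite mem_map ?hi /=; last by move=> ? ? [].
by rewrite andbT; apply/mapP => -[].
Qed.

Lemma wf_body : wf body_prog.
Proof.
rewrite /= ?wf_square_rel ?wf_var_rels ?wf_pair_rel ?wf_constraint //.
rewrite ?(inE, mem_cat, bound_emit_words, bound_constraint) //.
Qed.

Lemma vars_power_prog j s : (inl j : pvar) != vn -> (inl j \in vars (power_prog s)) = false.
Proof. by move=> h; elim: s => //= i s IH; rewrite !inE IH (negbTE h). Qed.

Lemma bound_power_prog j s : uniq s -> ((inl j : pvar) \in bound (power_prog s)) = false.
Proof.
move=> /wf_power_prog/andP[_ /eqP->].
by apply/mapP => -[].
Qed.

Lemma bound_body : all [in [:: vR; vP; vi; vj; q1; q2; q3; q4; vt; vu]] (bound body_prog).
Proof.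
set P := [in _]; have Pt ws : all P (bound (emit_words vt ws)) by apply: all_bound_emit_words.
by rewrite /=; do ?[rewrite !(all_cat, Pt) /=].
Qed.

Lemma wf_reduction : wf reduction_prog && (vn \notin bound reduction_prog).
Proof.
have /andP[wfp _] := wf_power_prog (enum_uniq 'I_k).
have vp := vars_power_prog (j := @Ordinal 16 1 isT) (enum 'I_k) isT.
have bp j := bound_power_prog j (enum_uniq 'I_k).
have bb v : v \notin [:: vR; vP; vi; vj; q1; q2; q3; q4; vt; vu] ->
    (v \in bound body_prog) = false.
  by move=> hv; apply: contraNF hv; apply: (allP bound_body).
(* The body is generalised so that simplification does not unfold it; only its well-formedness and
   its bound variables matter. *)
have wb := wf_body; rewrite /reduction_prog; move: body_prog bb wb => b bb wb.
rewrite /bound_prog /= wfp wb.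
rewrite !(inE, mem_cat, vp, bp, bb) //=.

Qed.

Section Correctness.
Variable x : seq bool.
Let T := polyb c k (size x).
Let N := (T.+1 * width x T) * B.
Let cls := flatten (map (clauses_of e0) (tableau M x T)).

Lemma sem_reduction : sem x reduction_prog (input_store vn x) =
  wenc N.+2 (base_rels N ++ map wclause cls).
Proof.
rewrite /reduction_prog sem_Let size_bound_prog !sem_LetE // sem_Let.
rewrite [sem x (For _ _ _) _]/= (size_flatten_iota _ (a := B)); last by move=> i; rewrite size_nseq.
apply: sem_body; last first.
  rewrite upd_same /N; congr (_ * _).
  by rewrite /value /upd /= /input_store /upd /= -/T /width /origin; lia.
by split; rewrite /value /upd /= /input_store /upd /= -/T /width /origin; lia.
Qed.

Lemma clauses_bound :
  all (fun cl => (cl != [::]) && all (fun p => p.1 < N) cl) cls.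
Proof.
rewrite /cls all_flatten_map; apply: sub_all (tableau_slots M x T) => K /andP[hne hb].
exact: clauses_of_bound hb hne.
Qed.

Lemma words_bound : all (all (fun l => l.1 < N.+2)) (base_rels N ++ map wclause cls).
Proof.
pose Q i := i < N.+2; pose WQ := @letters nat Q.
have hl i : Q i -> WQ (ltr i) by rewrite /WQ /letters /= => ->.
have hc u v : WQ u -> WQ v -> WQ (wcomm u v) by exact: letters_wcomm.
have lit p : Q p.1.+2 -> WQ (wlit p).
  by case: p => i [] /= hp; rewrite /WQ /letters /= hp.
have hclause cl : all (fun p => Q p.1.+2) cl -> WQ (wclause cl).
  move=> h; apply: letters_foldl_wcomm => //; rewrite all_map.
  by apply: sub_all h => p; apply: lit.
change (is_true (all WQ (base_rels N ++ map wclause cls))).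
rewrite all_cat; apply/andP; split; last first.
  rewrite all_map; apply: sub_all clauses_bound => cl /andP[_ h].
  by apply: hclause; apply: sub_all h => p.
rewrite /base_rels -cat1s !all_cat !all_flatten_map; apply/and3P; split=> //.
- apply/all_iotaP => i hi; apply/allP => w; rewrite !inE => /or3P[] /eqP->.
  + by rewrite /WQ /letters all_cat; apply/andP; split; apply: hl.
  + by apply: hc; apply: hl.
  + by apply: hclause; rewrite /= /Q !ltnS hi.
- apply/all_iotaP => i hi; rewrite all_map; apply/all_iotaP => j hj.
  by apply: hc; apply: hl.
Qed.

End Correctness.
End Reduction.

(** In both cases n has an odd divisor greater than 1, which is coprime to every power of two. *)
Lemma odd_factor_not_dvdn_exp2 n : 1 < n ->
  (odd n \/ exists b c : nat, [/\ 1 < b, 1 < c, odd c & n = 2 ^ b * c]) ->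
  forall k, ~~ (n %| 2 ^ k).
Proof.
have H m k : 1 < m -> odd m -> ~~ (m %| 2 ^ k).
  move=> m1 om; apply/negP => d; have : coprime m (2 ^ k) by rewrite coprimeXr // coprimen2.
  by rewrite /coprime (gcdn_idPl d) => /eqP e; rewrite e in m1.
move=> n1 [on|[b [c [_ c1 oc ->]]]] k; first exact: H.
by apply: contra (H c k c1 oc); apply: dvdn_trans; apply: dvdn_mull.
Qed.

(* 'D_(n.*2) = mathcomp's dihedral group of order 2n (extremal.v). *)
Theorem theorem7p19 (n : nat) :
  1 < n ->
  (odd n \/ exists b c : nat, [/\ 1 < b, 1 < c, odd c & n = 2 ^ b * c]) ->
  NP_hard (EPI [set: gsort 'D_(n.*2)]%G).
Proof.
move=> n1 hn; have n2 := odd_factor_not_dvdn_exp2 n1 hn.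
move=> L [M [c [k hL]]].
have /andP[wfE n0E] := wf_reduction M c k.
have [R [c' [k' hR]]] := loop_program_poly wfE n0E.
exists R, c', k' => x; eexists; split; first exact: hR.
(* Membership in [L] becomes in turn a certificate, a tableau, a satisfying valuation and an
   epimorphism; [polyb c k (size x)] is both the length bound of the certificate and the number of
   steps. *)
rewrite sem_reduction hL -tableau_correct -(satisfiable_clauses (empty_cell M)).
rewrite -(dihedral_epi_solution n1 n2 (clauses_bound M c k x)).
by rewrite -(EPI_wenc [set: gsort 'D_(n.*2)]%G (words_bound M c k x)).
Qed.
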